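(* Let $d\ge 1$ be a fixed integer. For each $n$, let $A_n$ be one of the following random $n\times n$ matrix models (the same model being used for all $n$): (i) the sum of $d$ independent uniform random permutation matrices of size $n\times n$; (ii) the sum of $d$ independent uniform random $n\times n$ permutation matrices, conditioned on the associated digraph being simple; (iii) the adjacency matrix of a uniform random directed $d$-regular graph on $n$ vertices. Let $\lambda_1,\dots,\lambda_n$ be the complex eigenvalues of $A_n$ (with multiplicity), ordered by decreasing modulus: $d=\lambda_1\ge|\lambda_2|\ge\dots\ge|\lambda_n|$. Then for any $\varepsilon>0$, $$\lim_{n\to\infty}\mathbb{P}\left(|\lambda_2|>\sqrt d+\varepsilon\right)=0.$$
   Context: A uniform random permutation matrix of size $n\times n$ is $P=(\mathbf 1_{\pi(i)=j})_{i,j\in[n]}$ with $\pi$ uniform in the symmetric group $S_n$. A nonnegative integer matrix $A$ is viewed as the (weighted) adjacency matrix of a digraph on $[n]=\{1,\dots,n\}$ (loops allowed). The digraph is simple if its adjacency matrix has no entry greater than $1$. A digraph is $d$-regular if every vertex has exactly $d$ in-neighbors and $d$ out-neighbors; the adjacency matrix of a uniform random directed $d$-regular graph is thus a uniformly chosen $n\times n$ matrix with entries in $\{0,1\}$ (loops allowed) whose row sums and column sums are all equal to $d$. Models (ii) and (iii) are considered for $n\ge d$. *)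

(* Defs.v *)
From HB Require Import structures.
From mathcomp Require Export all_boot all_order all_algebra all_fingroup.
From mathcomp Require Export complex.
From mathcomp Require Export reals topology normedtype sequences.
Set Implicit Arguments.
Unset Strict Implicit.
Unset Printing Implicit Defensive.
Import Order.TTheory GRing.Theory Num.Theory.
Export numFieldNormedType.Exports.

Local Open Scope ring_scope.
Local Open Scope complex_scope.

Section Spectrum.
Variable R : realType.

Definition complex_mx n (A : 'M[nat]_n) : 'M[R[i]]_n :=
  map_mx (fun k : nat => k%:R) A.

(* Decreasing modulus; ties are broken by decreasing real part, so that a
   positive real eigenvalue of maximal modulus comes first even when other
   eigenvalues have the same modulus (as for permutation matrices). *)
Definition spectral_order : rel R[i] := fun x y =>
  (`|y| < `|x|) || ((`|y| == `|x|) && (complex.Re y <= complex.Re x)).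

Definition eigenvalues n (A : 'M[nat]_n) : seq R[i] :=
  sort spectral_order
    (sval (closed_field_poly_normal (char_poly (complex_mx A)))).

(* Numbering starts at 1; the value is 0 when k is not in [1, n]. *)
Definition lambda n (A : 'M[nat]_n) (k : nat) : R[i] :=
  if k is k'.+1 then nth 0 (eigenvalues A) k' else 0.

Lemma char_poly_eigenvalues n (A : 'M[nat]_n) :
  char_poly (complex_mx A) = \prod_(z <- eigenvalues A) ('X - z%:P).
Proof.
rewrite /eigenvalues; case: closed_field_poly_normal => r /= {1}->.
rewrite (monicP (char_poly_monic _)) scale1r.
by apply: perm_big; rewrite perm_sym perm_sort.
Qed.

Lemma size_eigenvalues n (A : 'M[nat]_n) : size (eigenvalues A) = n.
Proof.
have := size_char_poly (complex_mx A).
by rewrite char_poly_eigenvalues size_prod_XsubC => -[].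
Qed.

Lemma eigenvalues_sorted n (A : 'M[nat]_n) :
  sorted (fun x y : R[i] => `|y| <= `|x|) (eigenvalues A).
Proof.
apply: (@sub_sorted _ spectral_order).
  by move=> x y /orP[/ltW //|/andP[/eqP-> _]].
apply: sort_sorted => x y; rewrite /spectral_order.
have /comparable_ltgtP : `|x| >=< `|y|.
  by rewrite real_comparable ?normr_real.
by case=> [_|_|_] /=; rewrite ?orbT //; apply: le_total.
Qed.

End Spectrum.

Section Models.

Definition perm_sum d n (s : {ffun 'I_d -> 'S_n}) : 'M[nat]_n :=
  \sum_(k < d) perm_mx (s k).

Definition simple_digraph n (A : 'M[nat]_n) : bool :=
  [forall i, forall j, (A i j <= 1)%N].

Definition regular_digraph d n (A : 'M[nat]_n) : bool :=
  [forall i, (\sum_j A i j == d)%N] && [forall j, (\sum_i A i j == d)%N].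

(* A 0/1 matrix is encoded by a boolean matrix, which makes 'M[bool]_n a
   finite type. *)
Definition adjacency n (B : 'M[bool]_n) : 'M[nat]_n := map_mx nat_of_bool B.

Variable R : realType.

Definition uniform_pr (T : finType) (S : {set T}) (E : pred T) : R :=
  #|[set x in S | E x]|%:R / #|S|%:R.

Definition uniform_cond_pr (T : finType) (S : {set T}) (E F : pred T) : R :=
  uniform_pr S (predI E F) / uniform_pr S F.

Inductive model := PermSum | SimplePermSum | RegularDigraph.

(* The probability that A_n satisfies E. Independent uniform permutations are
   a uniform element of the product {ffun 'I_d -> 'S_n}. *)
Definition model_pr (m : model) d n (E : pred 'M[nat]_n) : R :=
  match m with
  | PermSum =>
      uniform_pr [set: {ffun 'I_d -> 'S_n}] (fun s => E (perm_sum s))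
  | SimplePermSum =>
      uniform_cond_pr [set: {ffun 'I_d -> 'S_n}]
        (fun s => E (perm_sum s)) (fun s => simple_digraph (perm_sum s))
  | RegularDigraph =>
      uniform_pr [set B : 'M[bool]_n | regular_digraph d (adjacency B)]
        (fun B => E (adjacency B))
  end.

Definition admissible (m : model) (d n : nat) : bool :=
  if m is PermSum then (0 < n)%N else (d <= n)%N.

End Models.

Arguments model_pr : clear implicits.
Arguments lambda R {n} A k.

(* Main.v *)
(** All three models are the matrices [A s i j = #{a | (s (i, a)).1 = j}] of a
    uniform permutation [s] of the half-edges ['I_n * 'I_d], where [s] ranges
    over a set closed under the swaps of two half-edges with the same label:
    the label-preserving permutations for sums of permutations, all
    permutations (the configuration model) for regular digraphs.  Models (ii) and
    (iii) condition on simplicity, an event of probability bounded below.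

    Expanding the characteristic polynomial row by row, swapping two half-edges
    with the same label kills most of the second moment of its [j]-th
    coefficient, which is therefore at most [poly(j) * d^j], uniformly in [n].
    Counting closed walks, [tr (A^k) - d^k] has size of order [sqrt d ^ k] for
    each fixed [k].  Hence for any [rho > sqrt d], with high probability the
    polynomial [p(z) = \prod_(i >= 2) (1 - lambda_i z)] has coefficients
    [O(rho^k)] for all [k], and by Newton's identities so has [1 / p] for
    [k <= K].  The product of [p] and this truncated inverse is [1 + O(z^(K+1))],
    so that [p] has no zero in the disc of radius slightly less than
    [1 / rho]. *)
Require Import Defs.
From mathcomp Require Import ring lra zify.
Set Implicit Arguments.
Unset Strict Implicit.
Unset Printing Implicit Defensive.
Import Order.TTheory GRing.Theory Num.Theory.
Local Open Scope classical_set_scope.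
Local Open Scope ring_scope.
Local Open Scope complex_scope.

(** * Half-edge permutations and prescribed heads *)

Section HalfEdges.
Variables n d : nat.
Local Open Scope nat_scope.

(** The obstacle is uniformity: Markov's inequality controls only finitely many traces, for [n]
    large depending on their number [K], whereas there are [n] eigenvalues. So all random quantities
    enter one nonnegative [energy], weighted so that its mean is bounded independently of [K]. A
    threshold [L ^+ 2] for it is fixed first, then [K], and only then [n]. Traces up to [K] leave
    the rest of the spectrum free; the coefficient bounds, valid for every [j], are what controls
    the tail of the product. Invariance under same-label swaps replaces independence throughout:
    exchanging heads compares the probabilities of prescribed heads, exchanging tails cancels signs
    and drives the switchings towards simple digraphs. Hence sums of permutations and the
    configuration model need no separate treatment. The size [sqrt d ^ k] of the traces has two
    sources: the number of rooted [k]-cycles has mean near [d ^ k] and variance of order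
    [k * d ^ k], and a closed walk that is not a cycle is, away from rare tangles, a repetition of a
    cycle of length at most [k / 2]. *)

Definition half_edge := ('I_n * 'I_d)%type.

Definition relabel (a : 'I_d) (u v : 'I_n) : {perm half_edge} :=
  tperm (u, a) (v, a).

(** Right multiplication exchanges two heads, left multiplication two tails. Counting prescribed
    heads uses the former, sign cancellation and switching the latter. *)
Definition swap_closed (G : {set {perm half_edge}}) :=
  forall s a u v, s \in G ->
    ((s * relabel a u v)%g \in G) && ((relabel a u v * s)%g \in G).

(** Only the vertex of a head is prescribed, never its label, so the bounds do not depend on whether
    [G] preserves labels. *)
Definition meets (c : seq (half_edge * 'I_n)) (s : {perm half_edge}) : bool :=
  all (fun p => (s p.1).1 == p.2) c.

Variable G : {set {perm half_edge}}.
Hypothesis Gsw : swap_closed G.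

Definition nb_meeting c := #|[set s in G | meets c s]|.

(* If [s x] lies over [v], exchange it with the half-edge over [u] with the same
   label: as [u] is not prescribed by [c], the other constraints survive. *)
Lemma leq_nb_meeting_fresh c x u v :
  x \notin map fst c -> u \notin map snd c ->
  nb_meeting ((x, v) :: c) <= nb_meeting ((x, u) :: c).
Proof.
move=> xc uc.
pose h (s : {perm half_edge}) := (s * relabel (s x).2 v u)%g.
rewrite /nb_meeting -(@card_in_imset _ _ h); last first.
  move=> s t; rewrite !inE /= => /and3P [_ /eqP sx _] /and3P [_ /eqP tx _] e.
  have hx (r : {perm half_edge}) : (r x).1 = v -> h r x = (u, (r x).2).
    by move=> rx; rewrite permM /relabel -{1}rx -surjective_pairing tpermL.
  have [e2] : (u, (s x).2) = (u, (t x).2) by rewrite -hx // -hx // e.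
  by move: e; rewrite /h e2 => /mulIg.
apply/subset_leq_card/subsetP => _ /imsetP [s + ->].
rewrite !inE /= => /and3P [sG /eqP sx /allP sc].
case/andP: (Gsw (s x).2 v u sG) => -> _ /=.
rewrite permM /relabel -{1}sx -surjective_pairing tpermL eqxx /=.
apply/allP => p pc; rewrite permM tpermD ?sc //.
  rewrite -sx -surjective_pairing (inj_eq perm_inj).
  by apply: contraNneq xc => ->; apply: map_f.
apply: contraNneq uc => /(congr1 fst) /= ->.
by rewrite (eqP (sc _ pc)); apply: map_f.
Qed.

Lemma sum_nb_meeting c x : \sum_v nb_meeting ((x, v) :: c) = nb_meeting c.
Proof.
rewrite /nb_meeting -[RHS]sum1_card.
rewrite (partition_big (fun s : {perm half_edge} => (s x).1) predT) //=.
apply: eq_bigr => v _; rewrite -sum1_card; apply: eq_bigl => s.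
by rewrite !inE /= andbCA andbC.
Qed.

Lemma nb_meeting_cons_leq c p : nb_meeting (p :: c) <= nb_meeting c.
Proof.
apply/subset_leq_card/subsetP => s; rewrite !inE /= => /and3P [-> _ ->] //.
Qed.

(** At least [n - size c] vertices are not prescribed by [c]; each of them is the head of [x] at
    least as often as [v], and the counts over all vertices add up to [nb_meeting c]. *)
Lemma nb_meeting_cons c x v : x \notin map fst c ->
  nb_meeting ((x, v) :: c) * (n - size c) <= nb_meeting c.
Proof.
move=> xc; rewrite -(sum_nb_meeting c x).
rewrite (bigID (mem (map snd c))) /= addnC.
apply: leq_trans (leq_addr _ _).
apply: (@leq_trans (\sum_(u | u \notin map snd c) nb_meeting ((x, v) :: c))).
  rewrite sum_nat_const mulnC leq_mul2r; apply/orP; right.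
  rewrite leq_subLR -{1}(card_ord n) -(cardC (mem (map snd c))) leq_add2r.
  by rewrite -(size_map snd c); apply: card_size.
by apply: leq_sum => u; apply: leq_nb_meeting_fresh.
Qed.

Lemma nb_meeting_nil : nb_meeting [::] = #|G|.
Proof. by apply: eq_card => s; rewrite !inE andbT. Qed.

(** Conditionally on [c2], each further prescribed head costs a factor of order [1 / n]. Powers of
    [n] instead of falling factorials keep the bound meaningful for every [n]. *)
Lemma nb_meeting_cat_ffact c1 c2 : uniq (map fst (c1 ++ c2)) ->
  nb_meeting (c1 ++ c2) * n ^ size c1 <=
  nb_meeting c2 * (size c1 + size c2) ^ size c1.
Proof.
(* The base [m] is frozen because [size c1] decreases along the induction. *)
suff H m : size c1 + size c2 <= m -> uniq (map fst (c1 ++ c2)) ->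
    nb_meeting (c1 ++ c2) * n ^ size c1 <= nb_meeting c2 * m ^ size c1.
  exact: H.
elim: c1 => [|[x v] c1 IH] //=.
rewrite addSn => lm /andP [xc uc]; rewrite !expnS.
(* With [q] the number of remaining constraints, [N1 * (n - q) <= N2] and [N1 <= N2] add up to
   [N1 * n <= N2 * q.+1] when [q <= n]; otherwise [N1 <= N2] suffices. *)
have step : nb_meeting ((x, v) :: c1 ++ c2) * n <= nb_meeting (c1 ++ c2) * m.
  have := nb_meeting_cons v xc; have := nb_meeting_cons_leq (c1 ++ c2) (x, v).
  rewrite size_cat; move: lm; move: (size c1 + size c2) => q qm.
  move: (nb_meeting (_ ++ _)) (nb_meeting (_ :: _)) => N2 N1.
  move=> l1 l2; apply: leq_trans _ (leq_mul (leqnn _) qm); rewrite mulnS.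
  case: (leqP q n) => qn; last by rewrite (leq_trans _ (leq_addl _ _)) ?leq_mul // ltnW.
  by rewrite -[X in _ * X <= _](subnK qn) mulnDr leq_add // leq_mul.
rewrite mulnA; apply: (leq_trans (leq_mul step (leqnn _))).
rewrite mulnAC [X in _ <= X]mulnCA [X in _ <= X]mulnC leq_mul //.
exact: IH (ltnW lm) uc.
Qed.

Lemma nb_meeting_ffact c : uniq (map fst c) ->
  nb_meeting c * n ^_ (size c) <= #|G|.
Proof.
elim: c => [|[x v] c IH] /=; first by rewrite nb_meeting_nil muln1.
move=> /andP [xc uc]; rewrite ffactnSr mulnCA mulnC.
by apply: leq_trans (IH uc); rewrite leq_mul2r nb_meeting_cons ?orbT.
Qed.

(** When the heads are distinct, [v] itself is fresh, hence at least as likely as any other vertex,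
    so it gets at least the average over the [n] vertices. *)
Lemma nb_meeting_ge c : uniq (map fst c) -> uniq (map snd c) ->
  #|G| <= nb_meeting c * n ^ size c.
Proof.
elim: c => [|[x v] c IH] /=; first by rewrite nb_meeting_nil muln1.
move=> /andP [xc uc] /andP [vc uv]; apply: leq_trans (IH uc uv) _.
rewrite expnS mulnA leq_mul2r; apply/orP; right.
rewrite -(sum_nb_meeting c x) mulnC -[X in _ <= X * _](card_ord n) -sum_nat_const.
by apply: leq_sum => u _; apply: leq_nb_meeting_fresh.
Qed.

End HalfEdges.

(** * Second moment of the coefficients of the characteristic polynomial *)

Section Expansion.

(** Multilinearity in the rows: [f i] is the term chosen in row [i]. *)
Lemma det_sum_rows (F : comPzRingType) n (T : finType)
    (t : 'I_n -> T -> F) (m : 'I_n -> T -> 'I_n -> F) :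
  \det (\matrix_(i, k) \sum_o t i o * m i o k) =
  \sum_(f : {ffun 'I_n -> T})
    (\prod_i t i (f i)) * \det (\matrix_(i, k) m i (f i) k).
Proof.
rewrite /determinant.
under eq_bigr => s _.
  under eq_bigr => i _ do rewrite mxE.
  rewrite bigA_distr_bigA big_distrr /=.
  over.
rewrite exchange_big; apply: eq_bigr => f _ /=.
rewrite big_distrr; apply: eq_bigr => s _ /=.
rewrite big_split /= mulrCA; congr (_ * (_ * _)).
by apply: eq_bigr => i _; rewrite mxE.
Qed.

Variables n d : nat.
Implicit Types (s : {perm half_edge n d}) (f : {ffun 'I_n -> option 'I_d}).

Definition quotient_mx s : 'M[nat]_n :=
  \matrix_(i, j) (\sum_(a < d) ((s (i, a)).1 == j))%N.

(* [f] selects at most one outgoing half-edge per vertex; the unselected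
   vertices are sent to themselves. *)
Definition dest s f (i : 'I_n) : 'I_n :=
  if f i is Some a then (s (i, a)).1 else i.

Definition fsupp f : {set 'I_n} := [set i | f i != None].

(** The signature of [dest s f] when this map is a permutation, and 0 otherwise. *)
Definition wt s f : int := \det (\matrix_(i, k) (dest s f i == k)%:R).

(** The sum of the principal minors of size [j], that is, the [j]-th elementary symmetric function
    of the eigenvalues. *)
Definition elem s (j : nat) : int := \sum_(f | #|fsupp f| == j) wt s f.

(** Row [i] of the characteristic matrix is ['X] times the [i]-th unit row minus one unit row per
    half-edge out of [i]; [None] selects the former, [Some a] one of the latter. *)
Lemma char_poly_quotient_mx (F : comNzRingType) s :
  char_poly (map_mx (fun k : nat => k%:R : F) (quotient_mx s)) =
  \sum_f ((-1) ^+ #|fsupp f| * (wt s f)%:~R) *: 'X^(n - #|fsupp f|).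
Proof.
pose t (_ : 'I_n) (o : option 'I_d) : {poly F} := if o is Some a then -1 else 'X.
pose m (i : 'I_n) (o : option 'I_d) (k : 'I_n) : {poly F} :=
  ((if o is Some a then (s (i, a)).1 else i) == k)%:R.
have -> : char_poly (map_mx (fun k : nat => k%:R : F) (quotient_mx s)) =
    \det (\matrix_(i, k) \sum_o t i o * m i o k).
  congr (\det _); apply/matrixP => i k; rewrite !mxE.
  rewrite (bigD1 None) //= mulr_natr; congr (_ + _).
  rewrite rmorph_nat natr_sum -sumrN.
  rewrite [RHS](eq_bigl (fun o : option 'I_d => isSome o)); last by case.
  rewrite (reindex_omap (fun o : 'I_d => Some o) id) /=; last by case.
  apply: eq_big => [a|a _]; first by rewrite eqxx.
  by rewrite mulN1r.
rewrite det_sum_rows; apply: eq_bigr => f _.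
have -> : \det (\matrix_(i, k) m i (f i) k) = (wt s f)%:~R.
  rewrite /wt -(rmorph_int (@polyC F)) /=.
  rewrite -(det_map_mx (@intmul F 1)) -det_map_mx; congr (\det _).
  by apply/matrixP => i k; rewrite !mxE /m /dest !rmorph_nat.
have -> : \prod_i t i (f i) = (-1) ^+ #|fsupp f| * 'X^(n - #|fsupp f|).
  rewrite (bigID (mem (fsupp f))) /=; congr (_ * _).
    rewrite (eq_bigr (fun=> -1)) ?prodr_const // => i.
    by rewrite inE /t; case: (f i).
  have -> : (n - #|fsupp f| = #|~: fsupp f|)%N by rewrite [in RHS]cardsCs setCK card_ord.
  rewrite (eq_bigr (fun=> 'X)) => [|i]; last by rewrite inE /t; case: (f i).
  by rewrite -prodr_const; apply: eq_bigl => i; rewrite in_setC.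
rewrite mulrAC -mul_polyC rmorphM /= rmorphXn /= rmorphN1.
by rewrite (rmorph_int (@polyC F)).
Qed.

Lemma coef_char_poly_quotient_mx (F : comNzRingType) s (j : nat) :
  (j <= n)%N ->
  (char_poly (map_mx (fun k : nat => k%:R : F) (quotient_mx s)))`_(n - j) =
  (-1) ^+ j * (elem s j)%:~R.
Proof.
move=> jn; rewrite char_poly_quotient_mx coef_sum /elem.
rewrite rmorph_sum /= big_distrr [RHS]big_mkcond /=; apply: eq_bigr => f _.
rewrite coefZ coefXn.
have fn : (#|fsupp f| <= n)%N by rewrite -[X in (_ <= X)%N]card_ord max_card.
have -> : (n - j == n - #|fsupp f|)%N = (#|fsupp f| == j) by lia.
by case: eqP => [->|_]; rewrite ?mulr1 ?mulr0.
Qed.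

End Expansion.

Lemma card_small_subsets (T : finType) (B : {set T}) r :
  (#|[set A : {set T} | (A \subset B) && (#|A| <= r)]| <= #|B|.+1 ^ r)%N.
Proof.
have injS : injective (@Some T) by move=> ? ? [].
pose P := [pred o : option T | if o is Some x then x \in B else true].
have cP : #|P| = #|B|.+1.
  rewrite (cardD1 None) inE /= add1n; congr _.+1.
  rewrite -(card_imset (mem B) injS); apply: eq_card => -[x|].
    by rewrite !inE /= mem_imset //; apply: injS.
  by rewrite !inE /=; apply/esym/imsetP => -[].
rewrite -cP -[X in (_ <= _ ^ X)%N](card_ord r) -(card_ffun_on 'I_r P).
pose g (f : {ffun 'I_r -> option T}) := [set x | Some x \in codom f].
apply: leq_trans (leq_imset_card g _); apply/subset_leq_card/subsetP => A.
rewrite inE => /andP [AB Ar]; apply/imsetP.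
(* [A] is enumerated and the spare positions hold [None], which [g] discards. *)
exists [ffun i : 'I_r => nth None (map Some (enum A)) i].
  apply/ffun_onP => i; rewrite ffunE.
  case: (ltnP i (size (enum A))) => iA; last by rewrite nth_default ?size_map.
  case E: (nth _ _ _) => [x|] //; rewrite inE; apply: (subsetP AB).
  rewrite -mem_enum -(mem_map injS) -E mem_nth ?size_map //.
apply/setP => x; rewrite !inE; apply/idP/idP => [xA|/codomP [k]].
  have xi : (index x (enum A) < r)%N.
    by rewrite (leq_trans _ Ar) // cardE index_mem mem_enum.
  apply/codomP; exists (Ordinal xi); rewrite ffunE /=.
  by rewrite (nth_map x) ?nth_index ?index_mem ?mem_enum.
rewrite ffunE => E; rewrite -mem_enum -(mem_map injS) E.
case: (ltnP k (size (enum A))) => iA; first by rewrite mem_nth ?size_map.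
by rewrite nth_default ?size_map // in E.
Qed.

Section SecondMoment.
Variables n d : nat.
Implicit Types (s : {perm half_edge n d}) (f : {ffun 'I_n -> option 'I_d}).

Lemma wt_eq0 s f : ~~ injectiveb (dest s f) -> wt s f = 0.
Proof.
move=> /injectivePn [i [k ik e]]; apply: (determinant_alternate ik) => l.
by rewrite !mxE e.
Qed.

Lemma wt_perm s f (p : 'S_n) : dest s f =1 p -> wt s f = (-1) ^+ p.
Proof.
move=> e; rewrite /wt -det_perm; congr (\det _).
by apply/matrixP => i k; rewrite !mxE e.
Qed.

Lemma wt_norm s f : `|wt s f| = injectiveb (dest s f) :> int.
Proof.
case: (boolP (injectiveb _)) => [/injectiveP inj|/wt_eq0->]; last by rewrite normr0.
by rewrite (@wt_perm s f (perm inj)) ?normr_sign // => i; rewrite permE.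
Qed.

Definition edges f : {set half_edge n d} := [set x | f x.1 == Some x.2].

Lemma edges_fst_inj f : {in edges f &, injective fst}.
Proof.
move=> [i a] [k b]; rewrite !inE /= => /eqP fi /eqP fk ik.
by rewrite -ik fi in fk; case: fk => ->; rewrite ik.
Qed.

Lemma fst_edges f : [set x.1 | x in edges f] = fsupp f.
Proof.
apply/setP => i; rewrite inE; apply/imsetP/idP => [[x]|].
  by rewrite inE => /eqP fx ->; rewrite fx.
by case fi: (f i) => [a|] // _; exists (i, a); rewrite ?inE ?fi.
Qed.

Lemma card_edges f : #|edges f| = #|fsupp f|.
Proof. by rewrite -fst_edges card_in_imset //; apply: edges_fst_inj. Qed.

Variable G : {set {perm half_edge n d}}.
Hypothesis Gsw : swap_closed G.

(** A sign-reversing involution: exchanging the tails [(i, a)] and [(k, a)] swaps two rows of the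
    matrix of [f] and leaves that of [f'] unchanged, so the sum equals its opposite. *)
Lemma sum_wt_swap f f' (i k : 'I_n) a : i != k ->
  f i = Some a -> f k = Some a -> f' i != Some a -> f' k != Some a ->
  \sum_(s in G) wt s f * wt s f' = 0.
Proof.
move=> ik fi fk f'i f'k; pose h s := (relabel a i k * s)%g.
have hK : involutive h by move=> s; rewrite /h mulgA tperm2 mul1g.
have hG s : (h s \in G) = (s \in G).
  apply/idP/idP => sG; last by case/andP: (Gsw a i k sG).
  by case/andP: (Gsw a i k sG) => _; rewrite -/(h _) hK.
suff e : \sum_(s in G) wt s f * wt s f' = - \sum_(s in G) wt s f * wt s f'.
  by lia.
rewrite {1}(reindex_inj (inv_inj hK)) -sumrN; apply: eq_big => // s _.
rewrite -mulNr; congr (_ * _).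
  have -> : wt (h s) f = \det (xrow i k (\matrix_(i, k) (dest s f i == k)%:R : 'M[int]_n)).
    congr (\det _); apply/matrixP => l m; rewrite !mxE; congr (_ == _)%:R.
    rewrite /dest /h; case: (tpermP i k l) => [->|->|/eqP li /eqP lk].
    - by rewrite fi fk permM /relabel tpermL.
    - by rewrite fi fk permM /relabel tpermR.
    - case: (f l) => // b; rewrite permM /relabel tpermD //.
        by apply: contraNneq li => -[->].
      by apply: contraNneq lk => -[->].
  rewrite xrowE det_mulmx /tperm_mx det_perm odd_tperm ik expr1 mulN1r.
  by [].
congr (\det _); apply/matrixP => l m; rewrite !mxE; congr (_ == _)%:R.
rewrite /dest /h; case fl: (f' l) => [b|] //; rewrite permM /relabel tpermD //.
  by apply: contraNneq f'i => -[-> ->]; rewrite fl.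
by apply: contraNneq f'k => -[-> ->]; rewrite fl.
Qed.

(** Pigeonhole on the [d] labels: two of the half-edges selected by [f] but not by [f'] share a
    label, and [sum_wt_swap] applies to them. *)
Lemma sum_wt_far f f' : (d < #|edges f :\: edges f'|)%N ->
  \sum_(s in G) wt s f * wt s f' = 0.
Proof.
move=> lt_d.
have /dinjectivePn[x xE [y yE xy]] : ~~ dinjectiveb snd (mem (edges f :\: edges f')).
  apply/dinjectiveP => inj; move: lt_d; apply/negP; rewrite -leqNgt.
  by rewrite -(card_in_imset inj) -[X in (_ <= X)%N](card_ord d) max_card.
move: xE yE xy; case: x => i a; case: y => k b; rewrite !inE /=.
move=> /andP [f'i /eqP fi] /and3P [ki f'k /eqP fk] ab; rewrite -ab in f'k fk ki.

apply: (@sum_wt_swap f f' i k a) => //.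
by apply: contraNneq ki => ->.
Qed.

End SecondMoment.

Section Neighbours.
Variables n d : nat.
Implicit Types (s : {perm half_edge n d}) (f : {ffun 'I_n -> option 'I_d}).
Implicit Types p : 'S_n.
Local Open Scope nat_scope.

Definition differ f f' : {set 'I_n} := [set i | f i != f' i].

Lemma card_differ_supp f f' :
  #|differ f f' :&: fsupp f| = #|edges f :\: edges f'|.
Proof.
rewrite -(@card_in_imset _ _ fst (mem (edges f :\: edges f'))); last first.
  by move=> x y /setDP [xf _] /setDP [yf _]; apply: (@edges_fst_inj _ _ f).
apply: eq_card => i; rewrite !inE; apply/idP/imsetP => [/andP []|[[k a]]].
  case fi: (f i) => [a|] // fa _; exists (i, a) => //.
  by rewrite !inE fi eqxx andbT eq_sym.
rewrite !inE /= => /andP [fa /eqP fk] ->; rewrite fk andbT.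
by rewrite eq_sym.
Qed.

(** Both selections have equally many edges, so each has as many edges missing from the other; a
    differing vertex outside [fsupp f] carries an edge of [f'] that [f] lacks. *)
Lemma card_differ_out f f' : #|fsupp f| = #|fsupp f'| ->
  #|differ f f' :\: fsupp f| <= #|differ f f' :&: fsupp f|.
Proof.
move=> ff'; rewrite card_differ_supp.
have -> : #|edges f :\: edges f'| = #|edges f' :\: edges f|.
  by rewrite !cardsD !card_edges ff' setIC.
apply: leq_trans (leq_imset_card fst _).
apply/subset_leq_card/subsetP => i; rewrite !inE negbK => /andP [/eqP fi].
rewrite fi; case f'i: (f' i) => [a|] // _; apply/imsetP; exists (i, a) => //.
by rewrite !inE f'i fi eqxx.
Qed.

Lemma card_ffun_differ f D :
  #|[set f' | differ f f' == D]| <= d.+1 ^ #|D|.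
Proof.
pose g f' : {ffun 'I_n -> option 'I_d} := [ffun i => if i \in D then f' i else None].
rewrite -(@card_in_imset _ _ g); last first.
  move=> f1 f2; rewrite !inE => /eqP D1 /eqP D2 /ffunP e; apply/ffunP => i.
  have := e i; rewrite !ffunE; case: ifPn => // iD _.
  move: (iD); rewrite -{1}D1 inE negbK => /eqP <-.
  by move: (iD); rewrite -{1}D2 inE negbK => /eqP <-.
have -> : d.+1 = #|[pred o : option 'I_d | true]|.
  by rewrite -[LHS](card_ord d.+1) -[d in LHS](card_ord d) card_ord -card_option.
rewrite -(card_pffun_on None (mem D)).
apply/subset_leq_card/subsetP => _ /imsetP [f' _ ->].
apply/pffun_onP; split=> //; apply/subsetP => i; rewrite inE ffunE /=.
by case: ifP.
Qed.

Lemma card_perm_agree (D : {set 'I_n}) p :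
  #|[set p' : 'S_n | [forall i, (i \notin D) ==> (p' i == p i)]]| <= #|D|`!.
Proof.
rewrite -card_perm -(card_imset _ (mulIg p^-1)%g).
apply/subset_leq_card/subsetP => _ /imsetP [p' + ->].
rewrite inE => /forallP pp'; apply/subsetP => i; rewrite inE permM.
apply: contraR => iD; have := pp' i; rewrite iD /= => /eqP ->.
by rewrite permK.
Qed.

(** The pairs within one coefficient that [sum_wt_far] leaves uncancelled. *)
Definition near f f' :=
  (#|fsupp f'| == #|fsupp f|) && (#|edges f :\: edges f'| <= d).

(** The part of [D] outside [S] has at most [#|D :&: S|] vertices, each with about [n] choices,
    which the weight [n ^ (d - #|D :&: S|)] compensates. The part inside [S] has at most [d]
    vertices and costs only a power of [#|S|.+1]. *)
Lemma sum_differ (S : {set 'I_n}) : 0 < n ->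
  \sum_(D : {set 'I_n} | (#|D :&: S| <= d) && (#|D :\: S| <= #|D :&: S|))
     n ^ (d - #|D :&: S|) <= n ^ d * (#|S|.+1.*2) ^ d.
Proof.
move=> n0; rewrite (partition_big (fun D => D :&: S)
  [pred D1 : {set 'I_n} | (D1 \subset S) && (#|D1| <= d)]); last first.
  by move=> D /andP [Dd _]; rewrite /= subsetIr.
apply: (@leq_trans (\sum_(D1 in [set D1 : {set 'I_n} | (D1 \subset S) && (#|D1| <= d)])
   n ^ d * 2 ^ d)); last first.
  rewrite sum_nat_const mulnCA leq_mul // -muln2 expnMn leq_mul2r.
  by rewrite card_small_subsets orbT.
rewrite [X in X <= _](eq_bigl (fun D1 => D1 \in
  [set D1 : {set 'I_n} | (D1 \subset S) && (#|D1| <= d)])); last first.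
  by move=> D1; rewrite !inE.
apply: leq_sum => D1; rewrite inE => /andP [D1S D1d].
apply: (@leq_trans (\sum_(D in
  [set D : {set 'I_n} | (D :&: S == D1) && (#|D :\: S| <= #|D1|)]) n ^ (d - #|D1|))).
  rewrite leq_eqVlt; apply/orP; left; apply/eqP; apply: eq_big => D.
    rewrite !inE; case: eqP => [->|]; rewrite ?andbF // D1d andbT.
    by [].
  by move=> /andP [_ /eqP ->].
rewrite sum_nat_const mulnC.
apply: (@leq_trans (n ^ (d - #|D1|) * n.+1 ^ #|D1|)).
  rewrite leq_mul2l; apply/orP; right.
  (* Once [D :&: S = D1] is known, [D] is determined by [D :\: S]. *)
  rewrite -(@card_in_imset _ _ (fun D => D :\: S)); last first.
    move=> D E; rewrite !inE => /andP [/eqP D1e _] /andP [/eqP E1 _] e.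
    by rewrite -(setID D S) -(setID E S) D1e E1 e.
  rewrite -[X in X.+1](card_ord n) -cardsT.
  apply: leq_trans (card_small_subsets [set: 'I_n] #|D1|).
  apply/subset_leq_card/subsetP => _ /imsetP [D + ->].
  by rewrite !inE subsetT => /andP [_].
apply: (@leq_trans (n ^ (d - #|D1|) * (n * 2) ^ #|D1|)).
  rewrite leq_mul2l; apply/orP; right; case: (#|D1|) => // r.
  by rewrite leq_exp2r //; lia.
rewrite expnMn mulnA -expnD subnK // leq_mul2l leq_pexp2l ?orbT //.
Qed.

(** Near selections differ on a set [D] of at most [d.*2] vertices; the first two factors bound the
    choices of [f'] and [p'] for a given [D], and [sum_differ] sums over [D]. *)
Lemma sum_near f p : 0 < n ->
  \sum_(f' | near f f')
   \sum_(p' : 'S_n | [forall i, (i \notin differ f f') ==> (p' i == p i)])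
     n ^ (d - #|edges f :\: edges f'|)
  <= d.+1 ^ d.*2 * (d.*2)`! * (n ^ d * (#|fsupp f|.+1.*2) ^ d).
Proof.
move=> n0; apply: leq_trans (leq_mul (leqnn _) (sum_differ (fsupp f) n0)).
rewrite (partition_big (differ f) [pred D : {set 'I_n} |
  (#|D :&: fsupp f| <= d) && (#|D :\: fsupp f| <= #|D :&: fsupp f|)]) /=; last first.
  move=> f' /andP [/eqP e le]; rewrite card_differ_supp le /=.
  by rewrite -card_differ_supp card_differ_out.
rewrite big_distrr /=; apply: leq_sum => D /andP [D1 D2].
have D3 : #|D| <= d.*2.
  by rewrite -(cardsID (fsupp f) D) -addnn leq_add // (leq_trans D2).
apply: (@leq_trans (\sum_(f' in [set f' | differ f f' == D])
   (d.*2)`! * n ^ (d - #|D :&: fsupp f|))).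
  rewrite [X in X <= _](eq_bigl (fun f' =>
    (f' \in [set f' | differ f f' == D]) && near f f')); last first.
    by move=> f'; rewrite inE andbC.
  rewrite big_mkcondr /=; apply: leq_sum => f'; rewrite inE => /eqP Df'.
  case: ifP => // _; rewrite -card_differ_supp Df' sum_nat_const leq_mul2r.
  apply/orP; right.
  apply: (@leq_trans #|D|`!); last by rewrite leq_fact.
  by rewrite -(eq_card (in_set _)) card_perm_agree.
rewrite sum_nat_const mulnA leq_mul2r; apply/orP; right.
rewrite leq_mul2r; apply/orP; right.
by rewrite (leq_trans (card_ffun_differ f D)) // leq_pexp2l.
Qed.

End Neighbours.

Section SecondMomentBound.
Variables n d : nat.
Implicit Types (s : {perm half_edge n d}) (f : {ffun 'I_n -> option 'I_d}).
Implicit Types p : 'S_n.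
Variable G : {set {perm half_edge n d}}.
Hypothesis Gsw : swap_closed G.
Local Open Scope nat_scope.

Definition agrees f p s := [forall i, dest s f i == p i].

(** The event prescribes the heads of the [#|fsupp f|] edges of [f] and of the at most [d] edges
    that [f'] adds. The former have joint probability at most [1 / n ^_ #|fsupp f|], each of the
    latter costs a factor of order [1 / n]. *)
Lemma card_agrees f p f' p' : near f f' ->
  #|[set s in G | agrees f p s && agrees f' p' s]| *
    (n ^ d * n ^_ #|fsupp f|) <=
  n ^ (d - #|edges f :\: edges f'|) * (#|G| * (#|fsupp f| + d).+1 ^ d).
Proof.
move=> /andP [/eqP ff' rd]; set r := #|_ :\: _| in rd *.
pose c1 := [seq (x, p' x.1) | x <- enum (edges f' :\: edges f)].
pose c2 := [seq (x, p x.1) | x <- enum (edges f)].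
have fstc (q : 'S_n) (s : seq (half_edge n d)) :
    map fst [seq (x, q x.1) | x <- s] = s.
  by rewrite -map_comp map_id_in.
have u2 : uniq (map fst c2) by rewrite fstc enum_uniq.
have u12 : uniq (map fst (c1 ++ c2)).
  rewrite map_cat !fstc cat_uniq !enum_uniq andbT /= -all_predC.
  by apply/allP => x; rewrite mem_enum => xf; rewrite /= mem_enum in_setD xf.
have sz1 : size c1 = r.
  by rewrite size_map -cardE /r !cardsD !card_edges ff' setIC.
have sz2 : size c2 = #|fsupp f| by rewrite size_map -cardE card_edges.
have le : #|[set s in G | agrees f p s && agrees f' p' s]| <= nb_meeting G (c1 ++ c2).
  apply/subset_leq_card/subsetP => s; rewrite !inE => /and3P [-> /forallP sf /forallP sf'].
  rewrite /meets all_cat /=; apply/andP; split; apply/allP => _ /mapP [x + ->] /=.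
    rewrite mem_enum !inE => /andP [_ /eqP fx].
    by have := sf' x.1; rewrite /dest fx -surjective_pairing.
  rewrite mem_enum !inE => /eqP fx.
  by have := sf x.1; rewrite /dest fx -surjective_pairing.
have := nb_meeting_cat_ffact Gsw u12; have := nb_meeting_ffact Gsw u2.
rewrite sz1 sz2; set N := #|_| in le *; move: le; move: (nb_meeting _ (_ ++ _)) => N12 le.
move: (nb_meeting _ _) => N2 l2 l12.
rewrite -[in n ^ d](subnK rd) expnD mulnA mulnCA -!mulnA leq_mul2l; apply/orP; right.
rewrite mulnA; apply: (@leq_trans (N2 * (r + #|fsupp f|) ^ r * n ^_ #|fsupp f|)).
  by rewrite leq_mul2r (leq_trans _ l12) ?orbT // leq_mul2r le orbT.
rewrite mulnAC leq_mul //.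
apply: (@leq_trans ((#|fsupp f| + d).+1 ^ r)); last by rewrite leq_pexp2l.
by case: (r) rd => // r' rd; rewrite leq_exp2r //; lia.
Qed.

(** Limits the permutations to sum over: [p] moves only the support of [f], and [p'] is a
    modification of [p] on few vertices. *)
Lemma agrees_fix f p f' p' s : agrees f p s -> agrees f' p' s ->
  [forall i, (i \notin fsupp f) ==> (p i == i)] &&
  [forall i, (i \notin differ f f') ==> (p' i == p i)].
Proof.
move=> /forallP sf /forallP sf'; apply/andP; split; apply/forallP => i; apply/implyP.
  by rewrite inE negbK => /eqP fi; have := sf i; rewrite /dest fi eq_sym.
rewrite inE negbK => /eqP ff'.
by rewrite -(eqP (sf i)) -(eqP (sf' i)) /dest ff'.
Qed.

(** An injective destination map is a permutation; naming it [p] turns injectivity into a union of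
    events with prescribed heads. *)
Lemma sum_injective f f' :
  \sum_(s in G) injectiveb (dest s f) * injectiveb (dest s f') <=
  \sum_p \sum_p' #|[set s in G | agrees f p s && agrees f' p' s]|.
Proof.
have cardE p p' : #|[set s in G | agrees f p s && agrees f' p' s]| =
    \sum_(s in G) agrees f p s * agrees f' p' s.
  rewrite -sum1_card big_mkcond [RHS]big_mkcond; apply: eq_bigr => s _.
  by rewrite inE; case: (s \in G) (agrees f p s) (agrees f' p' s) => [] [] [].
under [leqRHS]eq_bigr => p _.
  under eq_bigr => p' _ do rewrite cardE.
  rewrite exchange_big; over.
rewrite [leqRHS]exchange_big; apply: leq_sum => s _ /=.
have inj_le h : injectiveb (dest s h) <= \sum_p agrees h p s.
  case: (boolP (injectiveb _)) => // /injectiveP inj.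
  rewrite (bigD1 (perm inj)) //= (_ : agrees h (perm inj) s = true) //.
  by apply/forallP => i; rewrite permE.
apply: leq_trans (leq_mul (inj_le f) (inj_le f')) _.
rewrite big_distrl; apply: leq_sum => p _; rewrite big_distrr; apply: leq_sum => p' _.
by [].
Qed.

Lemma card_ffun_supp j :
  #|[set f : {ffun 'I_n -> option 'I_d} | #|fsupp f| == j]| <= 'C(n, j) * d ^ j.
Proof.
rewrite -sum1_card (partition_big (@fsupp n d) (fun S => #|S| == j)) /=; last first.
  by move=> f; rewrite inE.
have -> : 'C(n, j) = #|[set S : {set 'I_n} | #|S| == j]|.
  by rewrite card_draws card_ord.
rewrite -sum_nat_const [X in X <= _](eq_bigl (fun S => S \in
  [set S : {set 'I_n} | #|S| == j])); last first.
  by move=> S; rewrite inE.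
apply: leq_sum => S; rewrite inE => /eqP Sj.
have dE : d = #|[pred o : option 'I_d | isSome o]|.
  rewrite -[LHS](card_ord d) -(card_image (f := @Some 'I_d)); last by move=> ? ? [].
  apply: eq_card => -[a|]; rewrite !inE ?image_f //.
  by apply/negbTE/imageP => -[].
rewrite -Sj [X in _ <= X ^ _]dE -(card_pffun_on None (mem S)) sum1_card.
apply/subset_leq_card/subsetP => f; rewrite -topredE /= inE => /andP [_ /eqP fS].
apply/pffun_onP; split; last first.
  by move=> o /imageP [k]; rewrite -fS !inE => h ->; case: (f k) h.
by rewrite -fS; apply/subsetP => i; rewrite !inE.
Qed.

(** The first two factors and the power of [j.+1.*2] come from [sum_near], the last one from
    [card_agrees]; the degree in [j] is [2 d]. *)
Definition moment_const (j : nat) : nat :=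
  d.+1 ^ d.*2 * (d.*2)`! * (j.+1.*2 ^ d * (j + d).+1 ^ d).

(** There are at most ['C(n, j) * d ^ j] selections [f] and [j] factorial permutations [p] for each,
    while each event has probability about [1 / n ^_ j]. Since ['C(n, j)] times [j] factorial is
    [n ^_ j], the dependence on [n] cancels and [d ^ j] remains. *)
Lemma sum_near_injective j : 0 < n -> j <= n ->
  \sum_(f : {ffun 'I_n -> option 'I_d} | #|fsupp f| == j) \sum_(f' | near f f')
     \sum_(s in G) injectiveb (dest s f) * injectiveb (dest s f') <=
  #|G| * d ^ j * moment_const j.
Proof.
move=> n0 jn.
have pos : 0 < n ^ d * n ^_ j by rewrite muln_gt0 expn_gt0 n0 ffact_gt0 jn.
rewrite -(leq_pmul2r pos).
pose fixes f p := [forall i, (i \notin fsupp f) ==> (p i == i)].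
pose K := #|G| * (j + d).+1 ^ d.
apply: (@leq_trans (\sum_(f : {ffun 'I_n -> option 'I_d} | #|fsupp f| == j)
  \sum_(p | fixes f p) \sum_(f' | near f f')
    \sum_(p' : 'S_n | [forall i, (i \notin differ f f') ==> (p' i == p i)])
      n ^ (d - #|edges f :\: edges f'|) * K)).
  rewrite big_distrl; apply: leq_sum => f /eqP fj /=.
  rewrite [leqRHS]exchange_big big_distrl; apply: leq_sum => f' nf /=.
  apply: leq_trans (leq_mul (sum_injective f f') (leqnn _)) _.
  rewrite big_distrl [leqRHS]big_mkcond; apply: leq_sum => p _ /=.
  rewrite big_distrl; case: ifPn => pf.
    rewrite [leqRHS]big_mkcond; apply: leq_sum => p' _ /=.
    case: ifPn => p'f; first by rewrite /K -fj card_agrees.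
    rewrite eq_card0 // => s; rewrite !inE; apply/negP => /and3P [_ a1 a2].
    by case/andP: (agrees_fix a1 a2) => _; apply/negP.
  rewrite big1 // => p' _; rewrite eq_card0 // => s; rewrite !inE; apply/negP => /and3P [_ a1 a2].
  by case/andP: (agrees_fix a1 a2) => + _; apply/negP.
apply: (@leq_trans (\sum_(f : {ffun 'I_n -> option 'I_d} | #|fsupp f| == j)
  j`! * (d.+1 ^ d.*2 * (d.*2)`! * (n ^ d * (j.+1.*2) ^ d) * K))).
  apply: leq_sum => f /eqP fj; rewrite -fj.
  apply: (@leq_trans (\sum_(p | fixes f p)
    d.+1 ^ d.*2 * (d.*2)`! * (n ^ d * (#|fsupp f|.+1.*2) ^ d) * K)).
    apply: leq_sum => p _.
    under eq_bigr do rewrite -big_distrl.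
    by rewrite -big_distrl leq_mul2r sum_near ?orbT.
  rewrite sum_nat_const leq_mul2r; apply/orP; right.
  have := card_perm_agree (fsupp f) 1%g; apply: leq_trans.
  apply/subset_leq_card/subsetP => p; rewrite -topredE /= inE => /forallP h.
  by apply/forallP => i; rewrite perm1.
rewrite sum_nat_const.
have -> : #|(fun f : {ffun 'I_n -> option 'I_d} => #|fsupp f| == j)| =
    #|[set f : {ffun 'I_n -> option 'I_d} | #|fsupp f| == j]|.
  by apply: eq_card => f; rewrite inE.
apply: leq_trans (leq_mul (card_ffun_supp j) (leqnn _)) _.
rewrite -bin_ffact /K /moment_const leq_eqVlt; apply/orP; left; apply/eqP.
by ring.
Qed.

(** Far pairs cancel exactly; for near pairs the signs are dropped, at the cost of the polynomial
    factor only. *)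
Lemma sum_elem_sqr j : 0 < n ->
  (\sum_(s in G) elem s j ^+ 2 <= (#|G| * d ^ j * moment_const j)%:Z)%R.
Proof.
move=> n0; case: (leqP j n) => jn; last first.
  rewrite big1 ?lez0_nat // => s _; rewrite /elem big1 ?expr0n // => f /eqP fj.
  by move: jn; rewrite -fj ltnNge -[X in (_ <= X)%N]card_ord max_card.
have -> : (\sum_(s in G) elem s j ^+ 2 =
    \sum_(f : {ffun 'I_n -> option 'I_d} | #|fsupp f| == j)
    \sum_(f' : {ffun 'I_n -> option 'I_d} | #|fsupp f'| == j)
    \sum_(s in G) wt s f * wt s f')%R.
  under eq_bigr => s _.
    rewrite expr2 big_distrl; under eq_bigr do rewrite big_distrr; over.
  by rewrite exchange_big; apply: eq_bigr => f _; rewrite exchange_big.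
have := sum_near_injective n0 jn; rewrite -lez_nat => /(le_trans _); apply.
rewrite (big_morph Posz PoszD erefl); apply: ler_sum => f /eqP fj.
rewrite (big_morph Posz PoszD erefl) [leRHS]big_mkcond [leLHS]big_mkcond; apply: ler_sum => f' _.
rewrite /near fj; case: eqP => //= fj'; case: leqP => [le|lt]; last first.
  by rewrite (sum_wt_far Gsw lt).
rewrite (big_morph Posz PoszD erefl); apply: ler_sum => s _; apply: le_trans (ler_norm _) _.
by rewrite normrM !wt_norm PoszM.
Qed.

End SecondMomentBound.

(** * Closed walks *)

Lemma sum_tupleS (V : nmodType) (T : finType) k (F : k.+1.-tuple T -> V) :
  \sum_t F t = \sum_x \sum_(t : k.-tuple T) F [tuple of x :: t].
Proof.
rewrite pair_big /= (reindex (fun p : T * k.-tuple T => [tuple of p.1 :: p.2])) //=.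
exists (fun t : k.+1.-tuple T => (thead t, [tuple of behead t])) => [[x t]|t] _ /=.
  by rewrite theadE; congr (_, _); apply: val_inj.
by rewrite [RHS]tuple_eta; apply: val_inj.
Qed.

Section Walks.
Variables n d : nat.
Local Notation X := (half_edge n d).
Implicit Types (s : {perm X}).

Definition follows s : rel X := fun x y => (s x).1 == y.1.

Definition closed_walks s k : {set k.-tuple X} :=
  [set t : k.-tuple X | path.cycle (follows s) t].

(** Cycles are rooted: rotations count separately, which makes the mean close to [d ^ k] rather than
    [d ^ k / k]. *)
Definition cycles s k : {set k.-tuple X} :=
  [set t in closed_walks s k | uniq (map fst t)].

Fixpoint walk s (i : 'I_n) (t : seq X) (j : 'I_n) : bool :=
  if t is x :: t' then (x.1 == i) && walk s (s x).1 t' j else i == j.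

Lemma mulmx_exp_walk (F : comNzRingType) s k (i j : 'I_n) :
  ((map_mx (fun k : nat => k%:R : F) (quotient_mx s)) ^+ k) i j =
  \sum_(t : k.-tuple X) (walk s i t j)%:R.
Proof.
elim: k i => [|k IH] i.
  rewrite expr0 mxE (big_pred1 [tuple]) //= => t; apply/esym/eqP.
  exact: tuple0.
rewrite exprS -mulmxE mxE sum_tupleS.
transitivity (\sum_(a < d) \sum_(t : k.-tuple X) (walk s (s (i, a)).1 t j)%:R : F).
  under eq_bigr => l _ do rewrite !mxE IH natr_sum big_distrl /=.
  rewrite exchange_big; apply: eq_bigr => a _ /=.
  rewrite (bigD1 (s (i, a)).1) //= eqxx mul1r [X in _ + X]big1 ?addr0 // => l ne.
  by rewrite eq_sym (negPf ne) mul0r.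
rewrite (bigID (fun x : X => x.1 == i)) /= [X in _ = _ + X]big1 ?addr0; last first.
  by move=> x ne; rewrite big1 // => t _; rewrite (negPf ne).
rewrite (reindex_omap (fun a : 'I_d => (i, a)) (fun x => Some x.2)) /=; last first.
  by case=> k' a /= /eqP ->.
apply: eq_big => [a|a _]; first by rewrite !eqxx.
by apply: eq_bigr => t _; rewrite eqxx.
Qed.

Lemma walk_path s x p j :
  walk s (s x).1 p j = path (follows s) x p && ((s (last x p)).1 == j).
Proof. by elim: p x => //= y p IH x; rewrite IH andbA eq_sym. Qed.

Lemma mxtrace_exp (F : comNzRingType) s k : (0 < k)%N ->
  \tr ((map_mx (fun k : nat => k%:R : F) (quotient_mx s)) ^+ k) =
  #|closed_walks s k|%:R.
Proof.
case: k => // k _; rewrite /mxtrace.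
under eq_bigr => i _ do rewrite mulmx_exp_walk.
rewrite exchange_big -sum1_card natr_sum [RHS]big_mkcond; apply: eq_bigr => t _.
case: (tupleP t) => x p /=; rewrite inE /= rcons_path.
rewrite (bigD1 x.1) //= eqxx walk_path big1 ?addr0 => [|i ne].
  by rewrite -mulrb.
by rewrite eq_sym (negPf ne).
Qed.

Definition cycle_constraints (t : seq X) : seq (X * 'I_n) :=
  zip t (map fst (rot 1 t)).

Lemma size_cycle_constraints t : size (cycle_constraints t) = size t.
Proof. by rewrite size1_zip // size_map size_rot. Qed.

Lemma fst_cycle_constraints t : map fst (cycle_constraints t) = t.
Proof. by rewrite -/(unzip1 _) unzip1_zip // size_map size_rot. Qed.

Lemma snd_cycle_constraints t : map snd (cycle_constraints t) = map fst (rot 1 t).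
Proof. by rewrite -/(unzip2 _) unzip2_zip // size_map size_rot. Qed.

Lemma meets_cycle s t : path.cycle (follows s) t = meets (cycle_constraints t) s.
Proof.
have meets_path x p : path (follows s) x p = meets (zip (belast x p) (map fst p)) s.
  by elim: p x => //= y p IH x; rewrite IH.
case: t => // x p; rewrite /= meets_path belast_rcons /cycle_constraints.
by rewrite rot1_cons.
Qed.

Lemma card_tuple_fst_uniq k :
  #|[set t : k.-tuple X | uniq (map fst t)]| = (n ^_ k * d ^ k)%N.
Proof.
pose h (p : k.-tuple 'I_n * k.-tuple 'I_d) : k.-tuple X := [tuple of zip p.1 p.2].
have hbij : bijective h.
  exists (fun t : k.-tuple X => ([tuple of map fst t], [tuple of map snd t])).
    move=> [a b]; congr (_, _); apply: val_inj => /=.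
      by rewrite -/(unzip1 _) unzip1_zip // !size_tuple.
    by rewrite -/(unzip2 _) unzip2_zip // !size_tuple.
  by move=> t; apply: val_inj; rewrite /= zip_unzip.
rewrite -sum1_card (reindex h) /=; last exact: onW_bij.
rewrite (eq_bigl (fun p : k.-tuple 'I_n * k.-tuple 'I_d => uniq p.1 && true)); last first.
  by move=> [a b]; rewrite inE andbT /= -/(unzip1 _) unzip1_zip // !size_tuple.
rewrite -(pair_big (fun a : k.-tuple 'I_n => uniq a) xpredT (fun _ _ => 1%N)) /=.
under eq_bigr do rewrite sum1_card card_tuple card_ord.
rewrite sum_nat_const; congr (_ * _)%N.
rewrite -[n in RHS]card_ord -card_uniq_tuples; apply: eq_card => t.
rewrite !inE [all _ _](_ : _ = true) //; exact/allP.
Qed.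

Variable G : {set {perm X}}.
Hypothesis Gsw : swap_closed G.
Local Open Scope nat_scope.

Lemma sum_card_tuples k (c : k.-tuple X -> bool) (m : k.-tuple X -> {perm X} -> bool) :
  \sum_(s in G) #|[set t : k.-tuple X | c t && m t s]| =
  \sum_(t | c t) #|[set s in G | m t s]|.
Proof.
under eq_bigr => s _ do rewrite -sum1_card big_mkcond.
rewrite exchange_big [RHS]big_mkcond; apply: eq_bigr => t _.
case: ifP => ct; last by rewrite big1 // => s _; rewrite inE ct.
rewrite -sum1_card big_mkcond [RHS]big_mkcond; apply: eq_bigr => s _.
by rewrite !inE ct /=; case: (s \in G).
Qed.

Lemma cyclesE s k : cycles s k =
  [set t : k.-tuple X | uniq (map fst t) && meets (cycle_constraints t) s].
Proof. by apply/setP => t; rewrite !inE meets_cycle andbC. Qed.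

(** There are [n ^_ k * d ^ k] tuples with distinct tail vertices, and each closes up with
    probability at most [1 / n ^_ k]. *)
Lemma sum_card_cycles_leq k : \sum_(s in G) #|cycles s k| <= #|G| * d ^ k.
Proof.
under eq_bigr do rewrite cyclesE.
rewrite sum_card_tuples.
(* For [k > n] the factor vanishes and there are no such tuples. *)
case: (posnP (n ^_ k)) => [n0|npos].
  rewrite big1 // => t ut; have := card_tuple_fst_uniq k; rewrite n0 mul0n.
  by move/card0_eq/(_ t); rewrite inE ut.
rewrite -(leq_pmul2r npos) big_distrl /= mulnAC -mulnA -card_tuple_fst_uniq mulnC.
rewrite -sum_nat_const [leqRHS](eq_bigl (fun t : k.-tuple X => uniq (map fst t))); last first.
  by move=> t; rewrite inE.
apply: leq_sum => t ut; rewrite -[X in _ ^_ X](size_tuple t).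
rewrite -size_cycle_constraints; apply: nb_meeting_ffact => //.
by rewrite fst_cycle_constraints (map_uniq ut).
Qed.

(** The heads prescribed along a cycle are its tail vertices rotated, hence distinct, as
    [nb_meeting_ge] requires. *)
Lemma sum_card_cycles_geq k :
  #|G| * (n ^_ k * d ^ k) <= (\sum_(s in G) #|cycles s k|) * n ^ k.
Proof.
under eq_bigr do rewrite cyclesE.
rewrite sum_card_tuples big_distrl /= -card_tuple_fst_uniq mulnC.
rewrite -sum_nat_const [leqLHS](eq_bigl (fun t : k.-tuple X => uniq (map fst t))); last first.
  by move=> t; rewrite inE.
apply: leq_sum => t ut; rewrite -[X in _ ^ X](size_tuple t).
rewrite -size_cycle_constraints; apply: nb_meeting_ge => //.
  by rewrite fst_cycle_constraints (map_uniq ut).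
by rewrite snd_cycle_constraints map_rot rot_uniq.
Qed.

(** Ordered pairs of vertex-disjoint cycles, concatenated so that the counting of tuples with
    distinct vertices applies again. *)
Definition disjoint_cycles s k : {set (k + k).-tuple X} :=
  [set t : (k + k).-tuple X | uniq (map fst t) &&
    meets (cycle_constraints (take k t) ++ cycle_constraints (drop k t)) s].

Lemma sum_card_disjoint_cycles k :
  \sum_(s in G) #|disjoint_cycles s k| <= #|G| * d ^ (k + k).
Proof.
rewrite sum_card_tuples.
case: (posnP (n ^_ (k + k))) => [n0|npos].
  rewrite big1 // => t ut; have := card_tuple_fst_uniq (k + k); rewrite n0 mul0n.
  by move/card0_eq/(_ t); rewrite inE ut.
rewrite -(leq_pmul2r npos) big_distrl /= mulnAC -mulnA -card_tuple_fst_uniq mulnC.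
rewrite -sum_nat_const [leqRHS](eq_bigl (fun t : (k + k).-tuple X => uniq (map fst t))); last first.
  by move=> t; rewrite inE.
apply: leq_sum => t ut.
set c := _ ++ _; have -> : k + k = size c.
  by rewrite /c size_cat !size_cycle_constraints -size_cat cat_take_drop size_tuple.
apply: nb_meeting_ffact => //.
by rewrite /c map_cat !fst_cycle_constraints cat_take_drop (map_uniq ut).
Qed.

End Walks.

(** * Rare dense configurations *)

Section Tangles.
Variables n d : nat.
Local Notation X := (half_edge n d).
Implicit Types (s : {perm X}) (S : {set X}).
Local Open Scope nat_scope.

(* The half-edges of [S] stay over the vertices of [S], and there are more of
   them than vertices; this has probability [O(1 / n)] for bounded [#|S|]. *)
Definition tangled s (S : {set X}) :=
  (#|[set x.1 | x in S]| < #|S|) && [forall x in S, (s x).1 \in [set y.1 | y in S]].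

Definition tangles s K : {set {set X}} := [set S : {set X} | (#|S| <= K) && tangled s S].

Variable G : {set {perm X}}.
Hypothesis Gsw : swap_closed G.

(** Union bound over the heads of the half-edges of [S]: fewer than [#|S|] vertices are allowed for
    each, and each full choice has probability at most [(#|S| / n) ^ #|S|]. *)
Lemma card_tangled (S : {set X}) : #|[set x.1 | x in S]| < #|S| ->
  #|[set s in G | tangled s S]| * n ^ #|S| <= #|G| * (#|S| ^ #|S| * #|S| ^ #|S|).
Proof.
move=> lt; set m := #|S|.
pose V := [set x.1 | x in S].
pose c (v : m.-tuple 'I_n) := zip (enum S) v.
have szE : size (enum S) = m by rewrite -cardE.
apply: (@leq_trans ((\sum_(v : m.-tuple 'I_n | all [in V] v) nb_meeting G (c v)) * n ^ m)).
  rewrite leq_mul2r; apply/orP; right.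
  have -> : #|[set s in G | tangled s S]| = \sum_(s in G) tangled s S.
    rewrite -sum1_card big_mkcond [RHS]big_mkcond; apply: eq_bigr => s _.
    by rewrite inE; case: (s \in G); case: tangled.
  have -> : \sum_(v : m.-tuple 'I_n | all [in V] v) nb_meeting G (c v) =
      \sum_(s in G) \sum_(v : m.-tuple 'I_n | all [in V] v) meets (c v) s.
    rewrite exchange_big; apply: eq_bigr => v _.
    rewrite /nb_meeting -sum1_card big_mkcond [RHS]big_mkcond; apply: eq_bigr => s _.
    by rewrite inE; case: (s \in G); case: meets.
  apply: leq_sum => s _; case: (boolP (tangled s S)) => // /andP [_ /forall_inP sS].
  have sz : size [seq (s x).1 | x <- enum S] == m by rewrite size_map szE.
  rewrite (bigD1 (Tuple sz)) /=; last first.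
    by apply/allP => _ /mapP [x + ->]; rewrite mem_enum; apply: sS.
  rewrite (_ : meets _ _ = true) //; apply/allP.
  by rewrite /c /=; elim: (enum S) => //= x e IH p; rewrite inE => /predU1P [->|/IH].
rewrite big_distrl /=.
apply: (@leq_trans (\sum_(v : m.-tuple 'I_n | all [in V] v) #|G| * m ^ m)).
  apply: leq_sum => v _.
  have szv : size (c v) = m by rewrite size1_zip szE ?size_tuple.
  have := @nb_meeting_cat_ffact _ _ _ Gsw (c v) [::]; rewrite cats0 /= addn0 szv.
  rewrite nb_meeting_nil; apply.
  by rewrite -/(unzip1 _) unzip1_zip ?enum_uniq // szE size_tuple.
rewrite sum_nat_const mulnC -mulnA leq_mul2l; apply/orP; right.
rewrite leq_mul2l; apply/orP; right.
apply: (@leq_trans (#|V| ^ m)); last first.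
  have : #|V| <= m by exact: ltnW.
  by case: (m) => // q le; rewrite leq_exp2r.
rewrite -[X in _ ^ X](card_ord m) -(card_ffun_on _ (mem V)).
rewrite -(card_image (f := fun v : m.-tuple 'I_n => [ffun i => tnth v i])); last first.
  by move=> v w /ffunP e; apply: eq_from_tnth => i; have := e i; rewrite !ffunE.
apply/subset_leq_card/subsetP => _ /imageP [v vV ->]; apply/ffun_onP => i.
by rewrite ffunE; apply: (allP vV); apply: mem_tnth.
Qed.

(** A crowded set of size [m] covers at most [m - 1] vertices, so the choice of vertices costs one
    factor [n] less than the [n ^ m] won in [card_tangled]. *)
Lemma card_crowded_sets m : 0 < n ->
  #|[set S : {set X} | (#|[set x.1 | x in S]| < #|S|) && (#|S| == m)]| * n <=
  n ^ m * (2 ^ m * 2 ^ (m * d)).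
Proof.
move=> n0; case: m => [|m].
  by rewrite eq_card0 // => S; rewrite !inE; case: eqP => [->|]; rewrite ?ltn0 ?andbF.
apply: (@leq_trans (n.+1 ^ m * 2 ^ (m.+1 * d) * n)); last first.
  apply: (@leq_trans ((n * 2) ^ m * 2 ^ (m.+1 * d) * n)).
    rewrite !leq_mul2r; apply/orP; right; apply/orP; right.
    by case: (m) => // q; rewrite leq_exp2r //; lia.
  rewrite expnMn !expnS; nia.
rewrite leq_mul2r; apply/orP; right.
rewrite -sum1_card (partition_big (fun S : {set X} => [set x.1 | x in S])
  [pred V : {set 'I_n} | (V \subset [set: 'I_n]) && (#|V| <= m)]) /=; last first.
  by move=> S; rewrite inE subsetT => /andP [lt /eqP Sm] /=; rewrite -ltnS -Sm.
rewrite [X in X <= _](eq_bigl (fun V => V \in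
  [set V : {set 'I_n} | (V \subset [set: 'I_n]) && (#|V| <= m)])); last first.
  by move=> V; rewrite [RHS]inE.
apply: (@leq_trans (\sum_(V in
  [set V : {set 'I_n} | (V \subset [set: 'I_n]) && (#|V| <= m)]) 2 ^ (m.+1 * d))); last first.
  rewrite sum_nat_const leq_mul2r; apply/orP; right.
  by apply: leq_trans (card_small_subsets _ _) _; rewrite cardsT card_ord.
apply: leq_sum => V; rewrite inE => /andP [_ Vm]; rewrite sum1_card.
apply: (@leq_trans #|powerset (setX V [set: 'I_d])|).
  apply/subset_leq_card/subsetP => S; rewrite -topredE /= => /andP [_ /eqP SV].
  rewrite powersetE; apply/subsetP => x xS; rewrite !inE andbT -SV.
  exact: imset_f.
rewrite card_powerset cardsX cardsT card_ord leq_pexp2l // leq_mul2r.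
by rewrite leqW ?orbT.
Qed.

Definition tangle_const K :=
  \sum_(m < K.+1) (m ^ m * m ^ m) * (2 ^ m * 2 ^ (m * d)).

Lemma sum_card_tangles K : 0 < n ->
  (\sum_(s in G) #|tangles s K|) * n <= #|G| * tangle_const K.
Proof.
move=> n0.
have -> : \sum_(s in G) #|tangles s K| =
    \sum_(m < K.+1) \sum_(S in [set S : {set X} | (#|[set x.1 | x in S]| < #|S|) && (#|S| == m)])
       #|[set s in G | tangled s S]|.
  rewrite [RHS](eq_bigr (fun m : 'I_K.+1 =>
    \sum_(S : {set X} | (#|S| <= K) && (inord #|S| == m))
      #|[set s in G | tangled s S]|)); last first.
    move=> m _; rewrite big_mkcond [RHS]big_mkcond; apply: eq_bigr => S _.
    rewrite !inE; case: (ltnP #|_| #|S|) => lt /=.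
      case: eqP => [Sm|Sm].
        have SK : #|S| <= K by rewrite Sm -ltnS.
        by rewrite SK -val_eqE /= inordK ?Sm ?eqxx.
      case: (leqP #|S| K) => SK //=; rewrite -val_eqE /= inordK //.
      by case: eqP.
    rewrite (_ : #|[set s in G | tangled s S]| = 0) ?if_same //.
    by apply: eq_card0 => s; rewrite !inE /tangled ltnNge lt andbF.
  rewrite -(partition_big (fun S : {set X} => inord #|S| : 'I_K.+1) predT) //=.
  under eq_bigr => s _ do rewrite -sum1_card big_mkcond.
  rewrite exchange_big [RHS]big_mkcond; apply: eq_bigr => S _.
  case: ifP => SK; last by rewrite big1 // => s _; rewrite inE SK.
  rewrite -sum1_card big_mkcond [RHS]big_mkcond; apply: eq_bigr => s _.
  by rewrite !inE SK /=; case: (s \in G).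
rewrite big_distrl /tangle_const big_distrr; apply: leq_sum => m _ /=.
have nm : 0 < n ^ m by rewrite expn_gt0 n0.
rewrite -(leq_pmul2r nm) mulnAC.
set A := [set S : {set X} | _].
apply: (@leq_trans ((\sum_(S in A) #|G| * (m ^ m * m ^ m)) * n)).
  rewrite leq_mul2r; apply/orP; right; rewrite big_distrl.
  apply: leq_sum => S; rewrite inE => /andP [lt /eqP Sm] /=.
  by have := card_tangled lt; rewrite Sm.
rewrite sum_nat_const mulnAC.
apply: leq_trans (leq_mul (card_crowded_sets m n0) (leqnn _)) _.
by rewrite leq_eqVlt; apply/orP; left; apply/eqP; ring.
Qed.

End Tangles.

Lemma leq_card_bigcup (I T : finType) (P : pred I) (F : I -> {set T}) :
  (#|\bigcup_(l | P l) F l| <= \sum_(l | P l) #|F l|)%N.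
Proof.
elim/big_rec2: _ => [|l m A _ le]; first by rewrite cards0.
by apply: leq_trans (leq_card_setU _ _) _; rewrite leq_add2l.
Qed.

(** * Structure of closed walks outside tangles *)

Section CycleStructure.
Variables n d : nat.
Local Notation X := (half_edge n d).
Variable s : {perm X}.
Local Notation e := (follows s).
Local Open Scope nat_scope.

(** If no two half-edges of [t] leave the same vertex, walking inside [t] is deterministic. *)
Lemma path_follows_inj (t p q : seq X) (a : X) :
  {in t &, injective fst} -> {subset p <= t} -> {subset q <= t} ->
  size p = size q -> path e a p -> path e a q -> p = q.
Proof.
move=> tinj; elim: p q a => [|x p IH] [|y q] a //= pt qt [szpq].
move=> /andP [/eqP ax xp] /andP [/eqP ay yq].
have xy : x = y.
  apply: tinj; [exact: pt (mem_head _ _) | exact: qt (mem_head _ _) | by rewrite -ax -ay].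
rewrite -xy in yq *; congr (_ :: _); apply: (IH _ x) => //.
  by move=> z zp; rewrite pt // inE zp orbT.
by move=> z zq; rewrite qt // inE zq orbT.
Qed.

(** By determinism, two closed walks of equal length that share a half-edge coincide once rotated to
    start there. *)
Lemma rot_cycle_eq (u t t' : seq X) x i j : {in u &, injective fst} ->
  {subset t <= u} -> {subset t' <= u} -> size t = size t' ->
  path.cycle e t -> path.cycle e t' -> i < size t -> j < size t' ->
  nth x t i = nth x t' j -> rot i t = rot j t'.
Proof.
move=> uinj tu t'u szt ct ct' it jt' eqn.
have Ei : rot i t = nth x t i :: (drop i.+1 t ++ take i t).
  by rewrite /rot (drop_nth x it).
have Ej : rot j t' = nth x t' j :: (drop j.+1 t' ++ take j t').
  by rewrite /rot (drop_nth x jt').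
have : path.cycle e (rot i t) by rewrite rot_cycle.
have : path.cycle e (rot j t') by rewrite rot_cycle.
have ti : {subset rot i t <= u} by move=> z; rewrite mem_rot; apply: tu.
have t'j : {subset rot j t' <= u} by move=> z; rewrite mem_rot; apply: t'u.
have szr : size (rot i t) = size (rot j t') by rewrite !size_rot.
move: ti t'j szr; rewrite Ei Ej eqn /= => ti t'j [szr].
rewrite !rcons_path => /andP [pj _] /andP [pi _]; congr (_ :: _).
apply: (path_follows_inj uinj) pi pj => // z zp; [apply: ti | apply: t'j];
  by rewrite inE zp orbT.
Qed.

Lemma cycle_head_mem (t : seq X) x : path.cycle e t -> x \in t ->
  (s x).1 \in [set y.1 | y in [set z in t]].
Proof.
move=> ct xt; have /eqP -> := next_cycle ct xt.
by apply: imset_f; rewrite inE mem_next.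
Qed.

(** Since the heads stay over the vertices of [t], not being tangled means having no more half-edges
    than vertices, hence one half-edge per vertex. *)
Lemma untangled_inj (t : seq X) :
  (forall x, x \in t -> (s x).1 \in [set y.1 | y in [set z in t]]) ->
  ~~ tangled s [set z in t] -> {in t &, injective fst}.
Proof.
move=> hd; rewrite /tangled negb_and -leqNgt => /orP [le|/forall_inPn [x]]; last first.
  by rewrite inE => xt; rewrite hd.
have /imset_injP inj : #|[set x.1 | x in [set z in t]]| == #|[set z in t]|.
  by rewrite eqn_leq leq_imset_card.
by move=> x y xt yt; apply: inj; rewrite inE.
Qed.

(** At most [k ^ k] tuples have a given range of size at most [k]. *)
Lemma leq_card_tangled (T : finType) k (A : {set T}) (h : T -> k.-tuple X) :
  injective h -> (forall t, t \in A -> tangled s [set z in h t]) ->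
  #|A| <= k ^ k * #|tangles s k|.
Proof.
move=> hinj At; rewrite -sum1_card.
rewrite (partition_big (fun t => [set z in h t]) (fun S => S \in tangles s k)) /=; last first.
  move=> t tA; rewrite inE At // andbT cardsE.
  by rewrite -[X in _ <= X](size_tuple (h t)) card_size.
rewrite mulnC -sum_nat_const; apply: leq_sum => S; rewrite inE => /andP [Sk _].
rewrite sum1_card; apply: (@leq_trans (#|S| ^ k)); last first.
  by case: (k) Sk => // q Sq; rewrite leq_exp2r.
rewrite -[X in _ ^ X](card_ord k) -(card_ffun_on _ (mem S)).
rewrite -(card_image (f := fun t => [ffun i => tnth (h t) i])); last first.
  by move=> v w /ffunP E; apply: hinj; apply: eq_from_tnth => i; have := E i; rewrite !ffunE.
apply/subset_leq_card/subsetP => _ /imageP [v + ->].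
rewrite -topredE /= => /andP [_ /eqP <-].
by apply/ffun_onP => i; rewrite ffunE inE mem_tnth.
Qed.

(** Two cycles are disjoint, or their union is tangled, or they meet in an untangled set and are
    then rotations of each other. *)
Lemma card_cycles_sqr k :
  #|cycles s k| ^ 2 <= #|disjoint_cycles s k| + k.+1 * #|cycles s k|
    + (k + k) ^ (k + k) * #|tangles s (k + k)|.
Proof.
pose cat2 (p : k.-tuple X * k.-tuple X) := [tuple of p.1 ++ p.2].
have cat_inj : injective cat2.
  move=> [t u] [t' u'] /(congr1 val) /= /eqP.
  by rewrite eqseq_cat ?size_tuple // => /andP [/eqP tt /eqP uu]; congr (_, _); apply: val_inj.
pose W := setX (cycles s k) (cycles s k).
pose A1 := [set p in W | uniq (map fst (cat2 p))].
pose A2 := [set p in W | tangled s [set z in cat2 p]].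
(* Rotations are indexed by [0..k] because the bound on [rot_add] is the length itself; this
   redundancy explains [k.+1] in the statement. *)
pose rots (p : k.-tuple X * 'I_k.+1) := (p.1, [tuple of rot p.2 p.1]).
have cW : #|cycles s k| ^ 2 = #|W| by rewrite cardsX expnS expn1.
have sub : W \subset A1 :|: [set rots p | p in setX (cycles s k) [set: 'I_k.+1]] :|: A2.
  apply/subsetP => -[t u] pW.
  case: (boolP (tangled s [set z in cat2 (t, u)])) => tang.
    by rewrite in_setU [_ \in A2]inE pW tang orbT.
  case: (boolP (uniq (map fst (cat2 (t, u))))) => un.
    by rewrite !in_setU [_ \in A1]inE pW un.
  rewrite !in_setU; apply/orP; left; apply/orP; right.
  move: pW; rewrite !inE /= => /andP [/andP [ct ut] /andP [cu uu]].
  have inj : {in t ++ u &, injective fst}.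
    apply: untangled_inj tang => x; rewrite mem_cat => /orP [xt|xu].
      have := cycle_head_mem ct xt; apply/subsetP/imsetS/subsetP => z.
      by rewrite !inE mem_cat => ->.
    have := cycle_head_mem cu xu; apply/subsetP/imsetS/subsetP => z.
    by rewrite !inE mem_cat orbC => ->.
  have : has [in map fst t] (map fst u).
    by apply: contraR un; rewrite /= map_cat cat_uniq ut uu andbT.
  case/hasP => _ /mapP [y yu ->] /mapP [x xt xy].
  have {xy} yx : y = x by apply: inj => //; rewrite mem_cat ?xt ?yu ?orbT.
  rewrite {y}yx in yu.
  have : rot (index x t) t = rot (index x u) u.
    apply: (rot_cycle_eq (x := x) inj) => //.
    - by move=> z zt; rewrite mem_cat zt.
    - by move=> z zt; rewrite mem_cat zt orbT.
    - by rewrite !size_tuple.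
    - by rewrite index_mem.
    - by rewrite index_mem.
    - by rewrite !nth_index.
  move=> /(congr1 (rotr (index x u))); rewrite rotK /rotr rot_rot_add => E.
  set l := rot_add _ _ _ in E.
  have lk : l < k.+1.
    by rewrite ltnS -[X in _ <= X](size_tuple t); apply: leq_rot_add.
  apply/imsetP; exists (t, Ordinal lk); first by rewrite !inE ct ut.
  by congr (_, _); apply: val_inj; rewrite /= -E.
rewrite cW; apply: leq_trans (subset_leq_card sub) _.
apply: leq_trans (leq_card_setU _ _) _; apply: leq_add; last first.
  by apply: (leq_card_tangled cat_inj) => p; rewrite inE => /andP [].
apply: leq_trans (leq_card_setU _ _) _; apply: leq_add; last first.
  by apply: leq_trans (leq_imset_card _ _) _; rewrite cardsX cardsT card_ord mulnC.
rewrite -(card_imset (mem A1) cat_inj).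
apply/subset_leq_card/subsetP => _ /imsetP [[t u] + ->].
rewrite [_ \in _]inE !inE /= => /andP [/andP [/andP [ct ut] /andP [cu uu]] ->] /=.
rewrite take_size_cat ?size_tuple // drop_size_cat ?size_tuple //.
by rewrite /meets all_cat -!/(meets _ _) -!meets_cycle ct cu.
Qed.

(** [l] is the least positive rotation, shorter than the walk, that fixes it; one exists because a
    half-edge is repeated. A repetition among the first [l] half-edges would give a smaller one. *)
Lemma nonsimple_period (t : seq X) : path.cycle e t -> ~~ uniq (map fst t) ->
  {in t &, injective fst} ->
  exists l, [/\ 0 < l, l.*2 <= size t, path.cycle e (take l t),
    uniq (map fst (take l t)) &
    forall x i, i < size t -> nth x t i = nth x (take l t) (i %% l)].
Proof.
move=> ct nu tinj.
have tu : ~~ uniq t by apply: contra nu => ?; rewrite map_inj_in_uniq.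
have rot_eq x i j : i < j -> j < size t -> nth x t i = nth x t j -> rot (j - i) t = t.
  move=> ij jt eqn; have it := ltn_trans ij jt.
  have := rot_cycle_eq tinj (fun _ h => h) (fun _ h => h) erefl ct ct it jt eqn.
  rewrite -{1}(subnKC (ltnW ij)) rotD ?subnKC 1?ltnW // => E.
  by apply: (@rot_inj i); rewrite -E.
have n0 : 0 < size t by case: (t) nu.
have [x0 _] : exists x, x \in t by case: (t) n0 => // x p _; exists x; apply: mem_head.
have ex : exists m, (0 < m < size t) && (rot m t == t).
  move/(uniqPn x0): tu => [i [j [ij jt eqn]]]; exists (j - i).
  by rewrite (rot_eq x0) // eqxx subn_gt0 ij (leq_ltn_trans (leq_subr _ _)).
case: (ex_minnP ex) => l /andP [/andP [l0 lt] /eqP rl] lmin.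
have shift x i : i + l < size t -> nth x t (i + l) = nth x t i.
  move=> il; rewrite -[in RHS]rl /rot nth_cat size_drop ltn_subRL (addnC l) il.
  by rewrite nth_drop addnC.
have per x i : i < size t -> nth x t i = nth x (take l t) (i %% l).
  move=> it; rewrite nth_take ?ltn_pmod //.
  move: it; rewrite {1 2}(divn_eq i l) addnC.
  elim: (i %/ l) => [|q IH] it; first by rewrite mul0n addn0.
  by rewrite mulSnr addnA shift ?IH //; move: it; rewrite mulSnr addnA //; lia.
(* Rotation by [size t - l] also fixes [t], so [l] is at most [size t - l] by minimality. *)
have l2 : l.*2 <= size t.
  suff : l <= size t - l by lia.
  apply: lmin; rewrite subn_gt0 lt /= -subn_gt0 subKn ?(ltnW lt) // l0 /=.
  apply/eqP; apply: (@rot_inj l); rewrite rl -rotD ?subnKC ?(ltnW lt) //.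
  by rewrite rot_size.
exists l; split=> //.
- move: ct (shift x0 0); rewrite add0n -{1}(cat_take_drop l t) (drop_nth x0 lt).
  case: (t) n0 l0 lt => // a t'; case: (l) => // l' _ _ /= lt.
  rewrite rcons_cat /= cat_path rcons_path => /andP [-> /= /andP [ex' _]] sh.
  by rewrite -[X in e _ X]sh.
- rewrite map_inj_in_uniq; last by move=> x y /mem_take xt /mem_take yt; apply: tinj.
  apply/negPn/(uniqPn x0) => -[i [j [ij]]]; rewrite size_takel ?(ltnW lt) // => jl.
  rewrite !nth_take ?(ltn_trans ij jl) // => eqn.
  have := lmin (j - i); rewrite (rot_eq x0) ?(ltn_trans jl lt) // eqxx subn_gt0 ij.
  by rewrite (leq_ltn_trans (leq_subr _ _)) ?(ltn_trans jl lt) //=; lia.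
Qed.

(** An untangled closed walk that is not a cycle repeats a cycle of length at most [k / 2], which
    determines it. *)
Lemma card_closed_walks_leq k : 0 < k ->
  #|closed_walks s k| <= #|cycles s k| + \sum_(l < k./2.+1 | 0 < l) #|cycles s l|
    + k ^ k * #|tangles s k|.
Proof.
move=> k0.
pose B := closed_walks s k :\: cycles s k.
have -> : #|closed_walks s k| = #|cycles s k| + #|B|.
  by rewrite -(cardsID (cycles s k)) (setIidPr _) //; apply/subsetP => t; rewrite inE => /andP [].
rewrite -addnA leq_add2l.
(* A member of [B] is picked only to supply the default half-edge [x0] for [nth]. *)
case: (pickP (mem B)) => [t0 _|B0]; last by rewrite eq_card0.
pose x0 := tnth t0 (Ordinal k0).
pose B1 := [set t in B | tangled s [set z in t]].
pose ext (l : nat) (u : l.-tuple X) := [tuple nth x0 u (i %% l) | i < k].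
have sub : B \subset
    \bigcup_(l < k./2.+1 | 0 < l) [set ext l u | u in cycles s l] :|: B1.
  apply/subsetP => t tB; rewrite in_setU [_ \in B1]inE tB /=.
  case: (boolP (tangled _ _)) => [|tang]; first by rewrite orbT.
  rewrite orbF; move: tB; rewrite !inE negb_and => /andP [/orP [/negP //|nu] ct].
  have inj : {in t &, injective fst}.
    by apply: untangled_inj tang => x; apply: cycle_head_mem.
  have [l [l0 l2 cl ul per]] := nonsimple_period ct nu inj.
  have lk : l < k./2.+1 by rewrite ltnS geq_half_double -[X in _ <= X](size_tuple t).
  apply/bigcupP; exists (Ordinal lk) => //=.
  have szl : size (take l t) == l by rewrite size_takel // (leq_trans _ l2) // -addnn leq_addr.
  apply/imsetP; exists (Tuple szl); first by rewrite !inE /= cl ul.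
  apply: eq_from_tnth => i; rewrite tnth_mktuple (tnth_nth x0) per //.
  by rewrite size_tuple.
apply: leq_trans (subset_leq_card sub) _; apply: leq_trans (leq_card_setU _ _) _.
apply: leq_add; last first.
  by apply: (@leq_card_tangled _ _ _ id) => // t; rewrite inE => /andP [].
apply: leq_trans (leq_card_bigcup _ _) _; apply: leq_sum => l _.
exact: leq_imset_card.
Qed.

End CycleStructure.

(** * Power series and Newton's identities *)

Lemma geom_sumr (R : comPzRingType) (q : R) k :
  (1 - q) * \sum_(l < k) q ^+ l = 1 - q ^+ k.
Proof. by rewrite -opprB mulNr -subrX1 opprB. Qed.

Section PowerSeries.
Variable C : numFieldType.
Implicit Types (s : seq C) (p : {poly C}).

(** The reversed polynomial of [\prod_(x <- s) ('X - x%:P)], whose roots are the inverses of the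
    nonzero elements of [s]. *)
Definition recip_poly s : {poly C} := \prod_(x <- s) (1 - x *: 'X).

Lemma size_recip_poly s : (size (recip_poly s) <= (size s).+1)%N.
Proof.
elim: s => [|x s IH]; rewrite /recip_poly ?big_nil ?size_poly1 // big_cons.
apply: leq_trans (size_polyMleq _ _) _; rewrite -/(recip_poly s).
have : (size ((1 - x *: 'X)%R : {poly C}) <= 2)%N.
  apply: leq_trans (size_polyD _ _) _; rewrite size_polyN size_poly1 geq_max /=.
  by apply: leq_trans (size_scale_leq _ _) _; rewrite size_polyX.
by move: IH; rewrite /=; lia.
Qed.

Lemma coef_recip_poly s j : (j <= size s)%N ->
  (recip_poly s)`_j = (\prod_(x <- s) ('X - x%:P))`_(size s - j).
Proof.
elim: s j => [|x s IH] j; first by rewrite leqn0 /recip_poly !big_nil => /eqP ->.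
rewrite /recip_poly !big_cons -/(recip_poly s) /= => js.
rewrite mulrBl mul1r -scalerAl mulrBl -mul_polyC.
rewrite !coefB !coefCM !coefXM.
case: j js => [|j] js /=.
  rewrite subn0 /= mulr0 !subr0 IH // subn0.
  rewrite [X in _ - _ * X]nth_default ?mulr0 ?subr0 //.
  by rewrite size_prod_XsubC.
rewrite (IH j) // subSS subn_eq0; congr (_ - _).
case: leqP => js'.
  by rewrite nth_default // (leq_trans (size_recip_poly _)).
by rewrite IH // subnS.
Qed.

Variable K : nat.

(** Agrees up to degree [K] with the inverse series of [recip_poly s], so these coefficients are the
    complete homogeneous symmetric functions of [s]. *)
Definition geom_prod s : {poly C} :=
  \prod_(x <- s) \sum_(l < K.+1) x ^+ l *: 'X^l.

Lemma recip_geom s : exists q, recip_poly s * geom_prod s = 1 + 'X^(K.+1) * q.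
Proof.
rewrite /recip_poly /geom_prod -big_split /=.
elim: s => [|x s [q IH]]; first by exists 0; rewrite big_nil mulr0 addr0.
rewrite big_cons IH.
have -> : (1 - x *: 'X) * (\sum_(l < K.+1) x ^+ l *: 'X^l) = 1 - x ^+ K.+1 *: 'X^(K.+1).
  rewrite -exprZn -[1 in RHS](expr1n _ K.+1) subrXX; congr (_ * _).
  by apply: eq_bigr => l _; rewrite expr1n mul1r exprZn.
exists (q - (x ^+ K.+1)%:P * (1 + 'X^(K.+1) * q)).
by rewrite -mul_polyC; ring.
Qed.

Definition psum s (k : nat) : C := \sum_(x <- s) x ^+ k.

(** Logarithmic derivative modulo ['X^(K.+1)]: by Leibniz, each new factor adds its own powers to
    the power sums. *)
Lemma geom_newton s : exists q, 'X * (geom_prod s)^`() =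
  (\sum_(l < K) psum s l.+1 *: 'X^(l.+1)) * geom_prod s + 'X^(K.+1) * q.
Proof.
elim: s => [|x s [q IH]].
  exists 0; rewrite /geom_prod big_nil derivC !mulr0 addr0 mulr1 big1 // => l _.
  by rewrite /psum big_nil scale0r.
rewrite /geom_prod big_cons -/(geom_prod s) derivM.
set g := \sum_(l < K.+1) _.
have [q' E] : exists q', 'X * g^`() = (\sum_(l < K) x ^+ l.+1 *: 'X^(l.+1)) * g + 'X^(K.+1) * q'.
  (* Equality of the low coefficients suffices; the quotient [q'] is what [drop_poly] leaves. In
     degree [l], both sides have coefficient [l] times [x ^+ l]. *)
  suff h l : (l < K.+1)%N -> ('X * g^`())`_l = ((\sum_(l < K) x ^+ l.+1 *: 'X^(l.+1)) * g)`_l.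
    pose D := 'X * g^`() - (\sum_(l < K) x ^+ l.+1 *: 'X^(l.+1)) * g.
    exists (drop_poly K.+1 D).
    have D0 : take_poly K.+1 D = 0.
      apply/polyP => m; rewrite coef_take_poly coef0 coefB.
      by case: ltnP => // /h ->; rewrite subrr.
    have := poly_take_drop K.+1 D; rewrite D0 add0r mulrC => ->.
    by rewrite /D addrC subrK.
  move=> lK.
  have gE : g = \poly_(m < K.+1) x ^+ m by rewrite poly_def.
  have tE : \sum_(l < K) x ^+ l.+1 *: 'X^(l.+1) = \poly_(m < K.+1) (if m == 0%N then 0 else x ^+ m).
    rewrite poly_def big_ord_recl /= scale0r add0r.
    by apply: eq_bigr => m _; rewrite /bump.
  rewrite tE gE coefXM coef_deriv coefM; case: l lK => [|l] lK /=.
    by rewrite big_ord_recl big_ord0 /= !coef_poly /= mul0r addr0.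
  rewrite coef_poly lK big_ord_recl [X in _ = X * _ + _]coef_poly /= mul0r add0r.
  rewrite (eq_bigr (fun=> x ^+ l.+1)) => [|m _].
    by rewrite sumr_const card_ord.
  have ml := ltn_ord m.
  rewrite !coef_poly /= /bump /= !add1n ifT; last by lia.
  rewrite ifT; last by lia.
  by rewrite -exprD; congr (_ ^+ _); lia.
exists (q' * geom_prod s + g * q).
rewrite mulrDr mulrA E mulrCA IH.
rewrite (_ : \sum_(l < K) psum (x :: s) l.+1 *: 'X^(l.+1) =
   \sum_(l < K) x ^+ l.+1 *: 'X^(l.+1) + \sum_(l < K) psum s l.+1 *: 'X^(l.+1)).
  by ring.
by rewrite -big_split; apply: eq_bigr => l _; rewrite /psum big_cons scalerDl.
Qed.

(** Newton's identities between complete homogeneous symmetric functions and power sums. *)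
Lemma coef_geom_newton s k : (k < K)%N ->
  (geom_prod s)`_k.+1 *+ k.+1 =
  \sum_(l < k.+1) psum s l.+1 * (geom_prod s)`_(k - l).
Proof.
move=> kK; have [q /(congr1 (fun p : {poly C} => p`_k.+1))] := geom_newton s.
rewrite coefXM coef_deriv /= => ->.
rewrite coefD coefXnM ltnS kK addr0 coefM big_ord_recl.
rewrite (_ : \sum_(l < K) psum s l.+1 *: 'X^(l.+1) =
  \poly_(m < K.+1) (if m == 0%N then 0 else psum s m)); last first.
  rewrite poly_def [RHS]big_ord_recl /= scale0r add0r.
  by apply: eq_bigr => m _; rewrite /bump.
rewrite coef_poly /= mul0r add0r; apply: eq_bigr => m _.
have mk := ltn_ord m.
by rewrite coef_poly /bump /= !add1n ltnS ifT ?subSS //; lia.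
Qed.

Lemma coef0_geom_prod s : (geom_prod s)`_0 = 1.
Proof.
elim: s => [|x s IH]; rewrite /geom_prod ?big_nil ?coef1 // big_cons.
rewrite coef0M -/(geom_prod s) IH mulr1 coef_sum big_ord_recl big1 ?addr0.
  by rewrite coefZ coefXn /= mulr1 expr0.
by move=> l _; rewrite coefZ coefXn /= mulr0.
Qed.

End PowerSeries.

(** * Coefficient bounds and a disc without zeros *)

Section Bounds.
Variable C : numFieldType.
Implicit Types (s : seq C) (p : {poly C}).

Lemma sum_geom_leq (t : C) k : 1 < t ->
  \sum_(l < k) t ^+ l <= t ^+ k / (t - 1).
Proof.
move=> t1; have t10 : 0 < t - 1 by rewrite subr_gt0.
rewrite ler_pdivlMr // mulrC -subrX1 gerBl ler01 //.
Qed.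

(** Dividing upwards would lose [dl ^+ k]. The recursion is instead solved downwards from degree
    [size p], where the coefficients vanish: each step divides by [dl > rho], hence contracts. *)
Lemma coef_quotient_bound (dl rho L : C) p : 0 < rho -> rho < dl -> 0 <= L ->
  (forall j, `|((1 - dl *: 'X) * p)`_j| <= L * rho ^+ j) ->
  forall k, `|p`_k| <= L * rho / (dl - rho) * rho ^+ k.
Proof.
move=> rho0 rhod L0 fb; set L1 := _ / _.
have dr0 : 0 < dl - rho by rewrite subr_gt0.
have d0 : 0 < dl by apply: lt_trans rhod.
have L10 : 0 <= L1 by rewrite divr_ge0 ?mulr_ge0 // ltW.
(* [L1] is the fixed point of the downward recursion, so the same constant serves at every step. *)
have L1E : (L1 + L) * rho = L1 * dl.
  by rewrite /L1; field; rewrite gt_eqF.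
suff h m k : (size p <= k + m)%N -> `|p`_k| <= L1 * rho ^+ k.
  by move=> k; apply: (h (size p)); rewrite leq_addl.
elim: m k => [|m IH] k szk.
  rewrite addn0 in szk; rewrite nth_default // normr0.
  by rewrite mulr_ge0 // exprn_ge0 // ltW.
have := fb k.+1; rewrite mulrBl mul1r -scalerAl coefB coefZ coefXM /= => fk.
rewrite -(ler_pM2r d0) mulrAC -L1E -mulrA -exprS -{1}[dl]gtr0_norm // mulrC -normrM.
rewrite -[X in `|X|](subKr p`_k.+1).
apply: le_trans (ler_normB _ _) _; rewrite mulrDl lerD // IH //.
by rewrite addSnnS.
Qed.

Section Inverse.
Variables (rho L : C) (K : nat) (s : seq C).
Hypotheses (rho0 : 0 < rho) (L0 : 0 <= L).
Hypothesis psumL : forall k, (0 < k <= K)%N -> `|psum s k| <= L * rho ^+ k.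
Local Notation h := (geom_prod K s).

Lemma coef_geom_recl (b : nat -> C) k : (k < K)%N ->
  (forall l, (l <= k)%N -> `|h`_l| <= b l * rho ^+ l) ->
  `|h`_k.+1| *+ k.+1 <= L * (\sum_(l < k.+1) b l) * rho ^+ k.+1.
Proof.
move=> kK hb; rewrite -normrMn coef_geom_newton //.
apply: le_trans (ler_norm_sum _ _ _) _.
rewrite [\sum_(l < _) b l](reindex_inj rev_ord_inj) mulr_sumr mulr_suml.
apply: ler_sum => l _; rewrite /= subSS normrM.
have lk : (l <= k)%N by rewrite -ltnS.
apply: le_trans (ler_pM (normr_ge0 _) (normr_ge0 _) (psumL _) (hb _ _)) _.
- by rewrite /= (leq_trans (ltn_ord l)).
- exact: leq_subr.
have kE : (k.+1 = l.+1 + (k - l))%N by lia.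
by rewrite [X in _ <= _ * rho ^+ X]kE exprD mulrACA.
Qed.

(** Ignores the division by [k.+1] in Newton's identities; [L] times the geometric sum of [1 + L]
    stays below the next power. *)
Lemma coef_geom_crude k : (k <= K)%N -> `|h`_k| <= (1 + L) ^+ k * rho ^+ k.
Proof.
have L10 : 0 <= 1 + L by rewrite addr_ge0.
elim/ltn_ind: k => -[|k] IH kK; first by rewrite coef0_geom_prod normr1 !expr0 mulr1.
apply: (@le_trans _ _ (`|h`_k.+1| *+ k.+1)).
  by rewrite -[leLHS]mulr1n ler_wpMn2l.
apply: le_trans (coef_geom_recl kK (b := fun l => (1 + L) ^+ l) _) _.
  by move=> l lk; apply: IH => //; apply: leq_trans kK; rewrite ltnW.
rewrite ler_wpM2r ?exprn_ge0 ?(ltW rho0) //.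
rewrite [X in X * _](_ : L = 1 + L - 1); last by rewrite addrC addrA addNr add0r.
by rewrite -subrX1 gerBl ler01.
Qed.

(** Beyond [k0] the division by [k.+1] absorbs [L / (t - 1)], so the growth per step drops from
    [1 + L] to [t], which may be chosen as close to 1 as desired; the crude bound up to [k0] leaves
    the constant. *)
Lemma coef_geom_bound (t : C) k0 : 1 < t -> L <= (t - 1) *+ k0 ->
  forall k, (k <= K)%N -> `|h`_k| <= (1 + L) ^+ k0 * t ^+ k * rho ^+ k.
Proof.
move=> t1 Lk0; have t10 : 0 < t - 1 by rewrite subr_gt0.
have t0 : 0 <= t by rewrite ltW // (lt_trans ltr01).
have L11 : 1 <= 1 + L by rewrite lerDl.
have L10 : 0 <= 1 + L by rewrite (le_trans ler01).
have B0 : 0 <= (1 + L) ^+ k0 by rewrite exprn_ge0.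
elim/ltn_ind => k IH kK; case: (leqP k k0) => kk0.
  apply: le_trans (coef_geom_crude kK) _.
  rewrite ler_wpM2r ?exprn_ge0 ?(ltW rho0) //.
  apply: (@le_trans _ _ ((1 + L) ^+ k0)); first exact: ler_weXn2l.
  by rewrite ler_peMr // exprn_ege1 // ltW.
case: k kk0 IH kK => [//|k] kk0 IH kK.
have k10 : (0 : C) < k.+1%:R by rewrite ltr0n.
rewrite -(ler_pM2r k10) !mulr_natr.
apply: le_trans (coef_geom_recl kK (b := fun l => (1 + L) ^+ k0 * t ^+ l) _) _.
  by move=> l lk; apply: IH => //; apply: leq_trans kK; rewrite ltnW.
rewrite -mulrnAl ler_wpM2r ?exprn_ge0 ?(ltW rho0) //.
rewrite -mulr_sumr mulrCA -mulrnAr ler_wpM2l //.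
apply: le_trans (ler_wpM2l L0 (sum_geom_leq _ t1)) _.
rewrite mulrA ler_pdivrMr // mulrnAl mulrC -mulrnAr ler_wpM2l ?exprn_ge0 //.
apply: le_trans Lk0 _; apply: ler_wpMn2l; first exact: ltW.
exact: ltnW.
Qed.

End Inverse.

(** The product [Q] is 1 plus terms of degree above [K], with coefficients of order
    [(t * rho) ^+ k]. At a root [z] those terms would sum to [-1], yet a geometric series bounds
    them by less than 1. *)
Lemma no_root_bound (rho L L1 t q z : C) K k0 s :
  0 < rho -> 0 <= L -> 0 <= L1 -> 1 < t -> L <= (t - 1) *+ k0 ->
  (forall k, (0 < k <= K)%N -> `|psum s k| <= L * rho ^+ k) ->
  (forall k, `|(recip_poly s)`_k| <= L1 * rho ^+ k) ->
  0 <= q -> q < 1 -> t * rho * `|z| <= q ->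
  (1 + L) ^+ k0 * L1 * t / (t - 1) * q ^+ K.+1 / (1 - q) < 1 ->
  (recip_poly s).[z] != 0.
Proof.
move=> rho0 L0 L10 t1 Lk0 psb cb q0 q1 tz lt1; apply/negP => /eqP pz.
have t10 : 0 < t - 1 by rewrite subr_gt0.
have t0 : 0 <= t by rewrite ltW // (lt_trans ltr01).
have B0 : 0 <= (1 + L) ^+ k0 by rewrite exprn_ge0 // addr_ge0.
(* Only the coefficients of [geom_prod] up to [K] are controlled, so the higher ones are cut off. *)
pose H := take_poly K.+1 (geom_prod K s).
have hb k : `|H`_k| <= (1 + L) ^+ k0 * t ^+ k * rho ^+ k.
  rewrite coef_take_poly; case: ltnP => kK; first exact: coef_geom_bound.
  by rewrite normr0 !mulr_ge0 ?exprn_ge0 ?addr_ge0 // ltW.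
pose Q := recip_poly s * H.
have Q1 k : (k <= K)%N -> Q`_k = (k == 0%N)%:R.
  move=> kK; have [r E] := recip_geom K s.
  have -> : Q`_k = (recip_poly s * geom_prod K s)`_k.
    rewrite !coefM; apply: eq_bigr => l _; rewrite coef_take_poly ifT //.
    by have := ltn_ord l; lia.
  by rewrite E coefD coefXnM ltnS kK addr0 coef1.
pose B := (1 + L) ^+ k0 * L1 * t / (t - 1).
have B00 : 0 <= B by rewrite /B !mulr_ge0 // invr_ge0 ltW.
have Qb k : `|Q`_k| <= B * (t * rho) ^+ k.
  rewrite /Q mulrC coefM; apply: le_trans (ler_norm_sum _ _ _) _.
  apply: (@le_trans _ _ (\sum_(l < k.+1) (1 + L) ^+ k0 * L1 * rho ^+ k * t ^+ l)).
    apply: ler_sum => l _; rewrite normrM.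
    apply: le_trans (ler_pM (normr_ge0 _) (normr_ge0 _) (hb _) (cb _)) _.
    have kE : rho ^+ k = rho ^+ l * rho ^+ (k - l) by rewrite -exprD subnKC // -ltnS.
    rewrite kE.
    by rewrite le_eqVlt; apply/orP; left; apply/eqP; ring.
  rewrite -mulr_sumr.
  apply: (@le_trans _ _ ((1 + L) ^+ k0 * L1 * rho ^+ k * (t ^+ k.+1 / (t - 1)))).
    by rewrite ler_wpM2l ?sum_geom_leq // !mulr_ge0 ?exprn_ge0 ?addr_ge0 // ltW.
  rewrite /B exprS exprMn le_eqVlt; apply/orP; left; apply/eqP.
  by field; rewrite gt_eqF.
have Qz : Q.[z] = 0 by rewrite hornerM pz mul0r.
have := Qz; rewrite (horner_coef_wide (n := (K.+1 + size Q)%N)) ?leq_addl //.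
rewrite big_split_ord /= [X in X + _](_ : _ = 1); last first.
  rewrite big_ord_recl big1 => [|l _]; first by rewrite Q1 // expr0 mulr1 addr0.
  by rewrite Q1 /= ?mul0r // lift0.
move/eqP; rewrite addrC addr_eq0 => /eqP E.
suff : (1 : C) < 1 by rewrite ltxx.
apply: le_lt_trans lt1; rewrite -[leLHS]normr1 -normrN -[X in `|X|]E -/B.
apply: le_trans (ler_norm_sum _ _ _) _.
apply: (@le_trans _ _ (\sum_(l < size Q) B * q ^+ K.+1 * q ^+ l)).
  apply: ler_sum => l _; rewrite normrM normrX -mulrA -exprD.
  apply: le_trans (ler_wpM2r (exprn_ge0 _ (normr_ge0 _)) (Qb _)) _.
  rewrite -mulrA -exprMn ler_wpM2l //; apply: lerXn2r => //.
  by rewrite nnegrE !mulr_ge0 // ltW.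
rewrite -mulr_sumr ler_wpM2l ?(mulr_ge0 B00) ?exprn_ge0 //.
have q10 : 0 < 1 - q by rewrite subr_gt0.
by rewrite -div1r ler_pdivlMr // mulrC geom_sumr gerBl exprn_ge0.
Qed.

End Bounds.

(** * Spectrum of a regular digraph *)

Section TraceSpectrum.
Variable C : numClosedFieldType.

Lemma trig_exp n (T : 'M[C]_n) k : is_trig_mx T ->
  is_trig_mx (T ^+ k) /\ forall j, (T ^+ k) j j = T j j ^+ k.
Proof.
move=> /is_trig_mxP tT; elim: k => [|k [/is_trig_mxP tk dk]].
  rewrite expr0; split; first exact: scalar_mx_is_trig.
  by move=> j; rewrite mxE eqxx expr0.
rewrite exprS; split.
  apply/is_trig_mxP => j l jl; rewrite -mulmxE mxE big1 // => m _.
  case: (ltnP j m) => jm; first by rewrite tT ?mul0r.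
  by rewrite tk ?mulr0 // (leq_ltn_trans jm).
move=> j; rewrite -mulmxE mxE (bigD1 j) //= dk -exprS big1 ?addr0 // => m.
rewrite neq_ltn => /orP [mj|jm]; last by rewrite tT ?mul0r.
by rewrite tk ?mulr0.
Qed.

Lemma char_poly_similar n (P A : 'M[C]_n) : P \in unitmx ->
  char_poly (P *m A *m invmx P) = char_poly A.
Proof.
move=> Pu; rewrite /char_poly.
have -> : char_poly_mx (P *m A *m invmx P) =
    map_mx polyC P *m char_poly_mx A *m map_mx polyC (invmx P).
  rewrite /char_poly_mx mulmxBr mulmxBl -!map_mxM; congr (_ - _).
  rewrite mul_mx_scalar -scalemxAl -map_mxM mulmxV // map_mx1.
  by rewrite scalemx1.
rewrite !det_mulmx mulrAC -det_mulmx -map_mxM mulmxV // map_mx1 det1 mul1r.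
by [].
Qed.

(** By Schur triangularisation, the diagonal of a triangular conjugate lists the eigenvalues and its
    powers act entrywise on it; size 0 is treated apart. *)
Lemma mxtrace_exp_spectrum n (A : 'M[C]_n) (t : seq C) k :
  char_poly A = \prod_(x <- t) ('X - x%:P) -> \tr (A ^+ k) = psum t k.
Proof.
case: n A => [|n] A At.
  rewrite /mxtrace big_ord0; have := size_char_poly A; rewrite At size_prod_XsubC.
  by case: t {At} => // _; rewrite /psum big_nil.
have [//|P Pu] := @Schur _ _ A; rewrite /similar_to => trig.
have PU := unitarymx_unit Pu; rewrite conjumx // in trig.
set T := P *m A *m invmx P in trig.
have AE : A = invmx P *m T *m P.
  by rewrite /T !mulmxA mulVmx // mul1mx mulmxKV.
have -> : \tr (A ^+ k) = \tr (T ^+ k).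
  have -> : A ^+ k = invmx P *m T ^+ k *m P.
    elim: k => [|k IH]; first by rewrite !expr0 mulmx1 mulVmx.
    by rewrite !exprS -!mulmxE IH {1}AE !mulmxA mulmxK.
  by rewrite mxtrace_mulC mulmxA mulmxV // mul1mx.
have [_ dk] := trig_exp k trig; rewrite /mxtrace.
rewrite (eq_bigr (fun j => T j j ^+ k)) => [|j _]; last exact: dk.
have pe : perm_eq [seq T j j | j <- index_enum 'I_n.+1] t.
  apply: prod_XsubC_eq.
  by rewrite -At -(char_poly_similar A PU) char_poly_trig // big_map.
by rewrite /psum -(perm_big _ pe) big_map.
Qed.

End TraceSpectrum.

Section Spectrum.
Variables (R : realType) (n d : nat) (A : 'M[nat]_n).
Hypothesis Areg : regular_digraph d A.
Local Notation C := R[i].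
Local Notation M := (complex_mx R A).

(** For a left eigenvector, the sum of the moduli of the entries grows at most by the factor [d],
    because the row sums are [d]. *)
Lemma norm_eigenvalue_leq x : x \in eigenvalues R A -> `|x| <= d%:R.
Proof.
move=> xA; have : root (char_poly M) x.
  by rewrite char_poly_eigenvalues root_prod_XsubC.
rewrite -eigenvalue_root_char => /eigenvalueP [v vM v0].
have pos : 0 < \sum_j `|v 0 j|.
  rewrite lt_neqAle sumr_ge0 // andbT eq_sym; apply: contra v0 => /eqP s0.
  apply/eqP/rowP => j; rewrite mxE; apply/eqP; rewrite -normr_eq0.
  by apply/eqP; apply: (psumr_eq0P _ s0).
rewrite -(ler_pM2r pos) mulr_sumr.
have -> : \sum_j `|x| * `|v 0 j| = \sum_j `|(v *m M) 0 j|.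
  by apply: eq_bigr => j _; rewrite vM mxE normrM.
apply: (@le_trans _ _ (\sum_j \sum_k `|v 0 k| * (A k j)%:R)).
  apply: ler_sum => j _; rewrite mxE; apply: le_trans (ler_norm_sum _ _ _) _.
  by apply: ler_sum => k _; rewrite normrM !mxE normr_nat.
rewrite exchange_big mulr_sumr; apply: ler_sum => k _ /=.
rewrite -mulr_sumr -natr_sum mulrC.
by case/andP: Areg => /forallP /(_ k) /eqP -> _.
Qed.

Hypothesis n0 : (0 < n)%N.

Lemma degree_eigenvalue : d%:R \in eigenvalues R A.
Proof.
rewrite -root_prod_XsubC -char_poly_eigenvalues -eigenvalue_root_char.
apply/eigenvalueP; exists (const_mx 1).
  apply/rowP => j; rewrite !mxE mulr1.
  rewrite (eq_bigr (fun k => (A k j)%:R)) => [|k _]; last by rewrite !mxE mul1r.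
  by rewrite -natr_sum; case/andP: Areg => _ /forallP /(_ j) /eqP ->.
apply/eqP => /rowP /(_ (Ordinal n0)); rewrite !mxE => /eqP.
by rewrite oner_eq0.
Qed.

Lemma spectral_order_trans : transitive (@spectral_order R).
Proof.
move=> y x z; rewrite /spectral_order.
case/orP => [xy|/andP [/eqP xy rxy]]; case/orP => [yz|/andP [/eqP yz ryz]].
- by rewrite (lt_trans yz xy).
- by rewrite yz xy.
- by rewrite -xy yz.
- by rewrite yz xy eqxx (le_trans ryz rxy) orbT.
Qed.

Lemma spectral_order_total : total (@spectral_order R).
Proof.
move=> x y; rewrite /spectral_order.
have /comparable_ltgtP : `|x| >=< `|y| by rewrite real_comparable ?normr_real.
by case=> [_|_|_] /=; rewrite ?orbT //; apply: le_total.
Qed.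

(** Several eigenvalues may have modulus [d]. The tie-break makes the first one have real part at
    least [d], which together with modulus at most [d] forces it to be [d]. *)
Lemma eigenvalues_split : exists t, eigenvalues R A = d%:R :: t.
Proof.
have := degree_eigenvalue; have := norm_eigenvalue_leq.
have : sorted (@spectral_order R) (eigenvalues R A).
  exact: sort_sorted spectral_order_total _.
case: (eigenvalues R A) => // x t /= st xd; rewrite inE => /predU1P [->|dt].
  by exists t.
have := order_path_min spectral_order_trans st => /allP /(_ _ dt).
rewrite /spectral_order normr_nat => h.
have xle : `|x| <= d%:R by apply: xd; rewrite mem_head.
exists t; congr (_ :: _).
case/orP: h => [lt|/andP [/eqP E le]]; first by have := le_lt_trans xle lt; rewrite ltxx.
case: x E le {st xd xle} => a b E le.
have dE : (d%:R : C) = (d%:R : R)%:C by rewrite -(rmorph_nat (real_complex R)).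
rewrite dE in E le *; move: le => /= le.
have a0 : 0 <= a by rewrite (le_trans _ le).
move: E; rewrite normc_def => -[E].
have := sqr_sqrtr (addr_ge0 (sqr_ge0 a) (sqr_ge0 b)); rewrite -E => E2.
have b0 : b = 0.
  apply/eqP; rewrite -sqrf_eq0; apply/eqP/le_anti; rewrite sqr_ge0 andbT.
  rewrite -(lerD2l (a ^+ 2)) addr0 -E2; apply: lerXn2r => //; rewrite nnegrE //.
rewrite b0 in E2 *; congr (_ +i* _); apply/eqP.
by move: E2; rewrite expr0n addr0 => /eqP; rewrite eqrXn2 // eq_sym.
Qed.

Lemma lambda1 : lambda R A 1 = d%:R.
Proof. by have [t E] := eigenvalues_split; rewrite /lambda E. Qed.

End Spectrum.

(** * Expectations *)

Section Summability.
Variable R : rcfType.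
Implicit Type q : R.

(** [q ^+ k] is the least of the [k.+1] terms of a geometric sum. *)
Lemma linear_geom_leq q k : 0 <= q -> q < 1 -> k.+1%:R * q ^+ k <= (1 - q)^-1.
Proof.
move=> q0 q1; have q10 : 0 < 1 - q by rewrite subr_gt0.
rewrite -div1r ler_pdivlMr // mulrC.
apply: (@le_trans _ _ ((1 - q) * \sum_(l < k.+1) q ^+ l)).
  rewrite ler_wpM2l ?(ltW q10) // -[k.+1 in leLHS]card_ord mulr_natl -sumr_const.
  apply: ler_sum => l _; apply: ler_wiXn2l => //; first exact: ltW.
  by rewrite -ltnS.
by rewrite geom_sumr gerBl exprn_ge0.
Qed.

(** Writing [q] as the square of its root, one half pays for one linear factor and the other half
    goes to the induction. *)
Lemma poly_geom_bounded q m : 0 <= q -> q < 1 ->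
  exists2 B : R, 0 <= B & forall k, k.+1%:R ^+ m * q ^+ k <= B.
Proof.
elim: m q => [|m IH] q q0 q1.
  by exists 1 => // k; rewrite expr0 mul1r exprn_ile1 // ltW.
have sq0 := sqrtr_ge0 q.
have sq1 : Num.sqrt q < 1 by rewrite -sqrtr1 ltr_sqrt.
have [B B0 Bk] := IH _ sq0 sq1.
exists (B * (1 - Num.sqrt q)^-1) => [|k].
  by rewrite mulr_ge0 // invr_ge0 subr_ge0 ltW.
rewrite -[q in leLHS](sqr_sqrtr q0) -exprM mul2n -addnn exprD exprSr mulrACA.
apply: ler_pM; rewrite ?mulr_ge0 ?exprn_ge0 ?ler0n //.
exact: linear_geom_leq.
Qed.

Lemma sum_poly_geom q m : 0 <= q -> q < 1 ->
  exists2 B : R, 0 <= B & forall N, \sum_(k < N) k.+1%:R ^+ m * q ^+ k <= B.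
Proof.
move=> q0 q1; have sq0 := sqrtr_ge0 q.
have sq1 : Num.sqrt q < 1 by rewrite -sqrtr1 ltr_sqrt.
have sq10 : 0 < 1 - Num.sqrt q by rewrite subr_gt0.
have [B B0 Bk] := poly_geom_bounded m sq0 sq1.
exists (B * (1 - Num.sqrt q)^-1) => [|N].
  by rewrite mulr_ge0 // invr_ge0 ltW.
apply: (@le_trans _ _ (\sum_(k < N) B * Num.sqrt q ^+ k)).
  apply: ler_sum => k _.
  rewrite -[q in leLHS](sqr_sqrtr q0) -exprM mul2n -addnn exprD mulrA.
  by rewrite ler_wpM2r ?exprn_ge0.
rewrite -mulr_sumr ler_wpM2l // -div1r ler_pdivlMr // mulrC.
by rewrite geom_sumr gerBl exprn_ge0.
Qed.

End Summability.

(** The relative gap between [n ^_ k] and [n ^ k] is at most [k ^ 2 / n], cleared of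
    denominators. *)
Lemma ffact_expn_leq (n k : nat) : (n ^ k.+1 <= n ^_ k * n + k ^ 2 * n ^ k)%N.
Proof.
elim: k => [|k IH]; first by rewrite expn1 ffactn0 mul1n leq_addr.
have := leq_mul (leqnn n) IH; rewrite -expnS => /leq_trans; apply.
have h : (n * n ^_ k <= n ^_ k.+1 + k * n ^ k)%N.
  rewrite ffactnSr mulnC; have : (n ^_ k <= n ^ k)%N.
    by elim: k {IH} => // k IH; rewrite ffactnSr expnSr leq_mul // leq_subr.
  move: (n ^_ k) (n ^ k)%N => a b ab.
  by have := leq_mul (leqnn k) ab; have := leq_subLR; nia.
have := leq_mul h (leqnn n); rewrite (expnS n k).
move: (n ^_ k) (n ^_ k.+1) (n ^ k)%N => a b c; rewrite -!mulnn => le.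
have p1 := leq0n (n * c * k); have p2 := leq0n (n * c).
nia.
Qed.

Section Moments.
Variables (n d : nat) (G : {set {perm half_edge n d}}).
Hypotheses (Gsw : swap_closed G) (n0 : (0 < n)%N) (d0 : (0 < d)%N).

(** From this size of [n] on, the [O(1 / n)] errors of the next two lemmas are at most 1. *)
Definition excess_const (k : nat) : nat :=
  ((k + k) ^ (k + k) * tangle_const d (k + k) + 2 * (d ^ (k + k) * k ^ 2)
    + k ^ k * tangle_const d k)%N.

(** The square is expanded: the upper bound on the second moment and the lower bound on the mean
    both have leading term [d ^ (k + k)], which cancels. What is left is [k.+1 * d ^ k] plus an
    error at most 1, absorbed by one more [d ^ k]. *)
Lemma sum_cycles_variance (R : realFieldType) k : (excess_const k <= n)%N ->
  \sum_(s in G) (#|cycles s k|%:R - (d ^ k)%:R) ^+ 2 <=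
  (#|G| * (k.+2 * d ^ k))%:R :> R.
Proof.
move=> nk; have n0R : 0 < n%:R :> R by rewrite ltr0n.
have nk0 : 0 < (n ^ k)%:R :> R by rewrite ltr0n expn_gt0 n0.
pose S1 := (\sum_(s in G) #|cycles s k|)%N.
pose S2 := (\sum_(s in G) #|cycles s k| ^ 2)%N.
have -> : \sum_(s in G) (#|cycles s k|%:R - (d ^ k)%:R) ^+ 2 =
    S2%:R - 2 * (d ^ k)%:R * S1%:R + #|G|%:R * (d ^ k)%:R ^+ 2 :> R.
  under eq_bigr do rewrite sqrrB.
  rewrite !big_split /= sumr_const -[_ *+ #|G|]mulr_natl sumrN /S2 /S1 !natr_sum.
  congr (_ - _ + _); first by apply: eq_bigr => s _; rewrite natrX.
  by rewrite mulr_sumr; apply: eq_bigr => s _; rewrite -mulr_natl mulrA mulrAC.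
have le2 : (S2 * n <= #|G| * (d ^ (k + k) + k.+1 * d ^ k) * n +
    #|G| * ((k + k) ^ (k + k) * tangle_const d (k + k)))%N.
  have h : (S2 <= \sum_(s in G) #|disjoint_cycles s k| + k.+1 * S1 +
       (k + k) ^ (k + k) * \sum_(s in G) #|tangles s (k + k)|)%N.
    rewrite /S1 !big_distrr -!big_split; apply: leq_sum => s _ /=.
    exact: card_cycles_sqr.
  have h1 := sum_card_disjoint_cycles Gsw k.
  have h2 : (k.+1 * S1 <= k.+1 * (#|G| * d ^ k))%N.
    by rewrite leq_mul2l sum_card_cycles_leq ?orbT.
  have h3 := leq_mul (leqnn ((k + k) ^ (k + k))) (sum_card_tangles Gsw (k + k) n0).
  apply: leq_trans (leq_mul h (leqnn n)) _.
  rewrite mulnDl; apply: leq_add; last by rewrite -mulnA [leqRHS]mulnCA.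
  by rewrite leq_mul2r mulnDr leq_add ?orbT // mulnCA.
have le1 : (#|G| * d ^ k * n <= S1 * n + #|G| * d ^ k * k ^ 2)%N.
  have h := sum_card_cycles_geq Gsw k; rewrite -/S1 in h.
  have nkn : (0 < n ^ k)%N by rewrite expn_gt0 n0.
  rewrite -(leq_pmul2r nkn) mulnDl.
  apply: (@leq_trans (#|G| * d ^ k * (n ^_ k * n + k ^ 2 * n ^ k))).
    by rewrite -mulnA -expnS leq_mul2l ffact_expn_leq orbT.
  rewrite mulnDr leq_add //; last by rewrite mulnA.
  have := leq_mul h (leqnn n); rewrite -!mulnA [(n * n ^ k)%N]mulnC; apply: leq_trans.
  by rewrite [(n ^_ k * _)%N in leqRHS]mulnCA.
have {le1} le1 : #|G|%:R * (d ^ k)%:R * n%:R <=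
    S1%:R * n%:R + #|G|%:R * (d ^ k)%:R * k%:R ^+ 2 :> R.
  by rewrite -natrX -!natrM -natrD ler_nat.
have {le2} le2 : S2%:R * n%:R <= #|G|%:R * ((d ^ k)%:R ^+ 2 + k.+1%:R * (d ^ k)%:R) * n%:R +
    #|G|%:R * ((k + k) ^ (k + k) * tangle_const d (k + k))%:R :> R.
  by rewrite expr2 -(natrM _ (d ^ k)) -expnD -!(natrM, natrD) ler_nat.
have {nk} nk : ((k + k) ^ (k + k) * tangle_const d (k + k))%:R +
    2 * (d ^ k)%:R ^+ 2 * k%:R ^+ 2 <= n%:R :> R.
  rewrite expr2 -(natrM _ (d ^ k)) -expnD -(natrX _ k) -!(natrM, natrD) ler_nat.
  by apply: leq_trans nk; rewrite -mulnA leq_addr.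
have dk1 : 1 <= (d ^ k)%:R :> R by rewrite ler1n expn_gt0 d0.
rewrite -(ler_pM2r n0R) !natrM -[k.+2]addn1 natrD.
move: le1 le2 nk dk1; have g0 : 0 <= #|G|%:R :> R by exact: ler0n.
move: (#|G|%:R) g0 (d ^ k)%:R n%:R n0R (S1%:R) (S2%:R)
  ((k + k) ^ (k + k) * tangle_const d (k + k))%:R (k%:R ^+ 2) k.+1%:R.
move=> g g0 D N N0 s1 s2 T k2 k1 le1 le2 nk dk1.
have D0 : 0 <= D by rewrite (le_trans ler01).
have h1 := ler_wpM2l (mulr_ge0 (ler0n R 2) D0) le1.
have h2 := ler_wpM2l g0 nk.
have h3 := ler_wpM2l (mulr_ge0 g0 (ltW N0)) dk1.
lra.
Qed.

(** At most [k] shorter lengths contribute, each with mean at most [d ^ k./2]; the remaining unit of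
    [k.+1] pays for the tangles. *)
Lemma sum_nonsimple (R : realFieldType) k : (0 < k)%N -> (excess_const k <= n)%N ->
  \sum_(s in G) (#|closed_walks s k|%:R - #|cycles s k|%:R) <=
  (#|G| * (k.+1 * d ^ k./2))%:R :> R.
Proof.
move=> k0 nk; rewrite sumrB lerBlDr -!natr_sum -natrD ler_nat.
have h : (\sum_(s in G) #|closed_walks s k| <= \sum_(s in G) #|cycles s k| +
   \sum_(l < k./2.+1 | (0 < l)%N) \sum_(s in G) #|cycles s l| +
   k ^ k * \sum_(s in G) #|tangles s k|)%N.
  rewrite exchange_big /= big_distrr -!big_split; apply: leq_sum => s _ /=.
  exact: card_closed_walks_leq.
apply: leq_trans h _; rewrite addnAC [leqRHS]addnC -addnA leq_add2l addnC.
rewrite mulSn mulnDr addnC; apply: leq_add.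
  rewrite -(leq_pmul2r n0) -mulnA.
  apply: leq_trans (leq_mul (leqnn _) (sum_card_tangles Gsw k n0)) _.
  rewrite mulnCA -mulnA leq_mul2l; apply/orP; right.
  apply: (@leq_trans n); first by apply: leq_trans nk; rewrite leq_addl.
  by rewrite leq_pmull // expn_gt0 d0.
apply: (@leq_trans (\sum_(l < k./2.+1 | (0 < l)%N) #|G| * d ^ k./2)).
  apply: leq_sum => l l0; apply: leq_trans (sum_card_cycles_leq Gsw l) _.
  by rewrite leq_mul2l leq_pexp2l ?orbT // -ltnS.
rewrite sum_nat_const mulnCA leq_mul2l leq_mul2r; apply/orP; right; apply/orP; right.
apply: (@leq_trans k./2); last by rewrite -divn2 leq_div.
rewrite -[leqRHS](card_ord k./2) -[leqRHS](card_image (f := lift ord0)); last exact: lift_inj.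
apply/subset_leq_card/subsetP => l; rewrite -topredE /= => l0.
by case: (unliftP ord0 l) l0 => [j ->|->] // _; apply: image_f.
Qed.

End Moments.

Lemma moment_const_leq d j :
  (moment_const d j <= moment_const d 0 * d.+1 ^ d * j.+1 ^ d.*2)%N.
Proof.
rewrite /moment_const add0n -[j.+1.*2]muln2 -[1.*2]muln2 mul1n expnMn.
rewrite [(j.+1 ^ d.*2)%N](_ : _ = (j.+1 ^ d * j.+1 ^ d)%N); last by rewrite -expnD addnn.
have h : ((j + d).+1 ^ d <= d.+1 ^ d * j.+1 ^ d)%N.
  by rewrite -expnMn; case: (d) => // q; rewrite leq_exp2r //; nia.
have := leq_mul h (leqnn (d.+1 ^ d)).
have : (0 < d.+1 ^ d)%N by rewrite expn_gt0.
move: (j.+1 ^ d)%N ((j + d).+1 ^ d)%N (d.+1 ^ d)%N h => a b c h c0 _ .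
move: (d.*2)`! (d.+1 ^ d.*2)%N (2 ^ d)%N => u v w.
have hc : (b <= c * a * c)%N by apply: leq_trans h _; rewrite leq_pmulr.
have := leq_mul (leqnn (v * u * w * a)) hc.
by congr (_ <= _)%N; ring.
Qed.

(** * A single functional for Markov's inequality *)

Section Energy.
Variables (R : rcfType) (d : nat) (rho : R).
Hypotheses (d0 : (0 < d)%N) (rho0 : 0 < rho) (rhod : Num.sqrt d%:R < rho).

(** The excess of closed walks over cycles is nonnegative and only its mean is bounded, so it enters
    to the first power; the other terms are squared. *)
Definition energy n (s : {perm half_edge n d}) (K : nat) : R :=
  \sum_(j < n.+1) (elem s j)%:~R ^+ 2 / rho ^+ j ^+ 2 +
  \sum_(k < K.+1 | (0 < k)%N)
    ((#|cycles s k|%:R - (d ^ k)%:R) ^+ 2 / rho ^+ k ^+ 2 +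
     (#|closed_walks s k|%:R - #|cycles s k|%:R) / rho ^+ k).

(** With [q = sqrt d / rho < 1], the means of the terms are polynomial times [q ^+ 2 ^+ j] or
    [q ^+ k], hence summable. It is essential that [B] precedes [K], whereas [n0] may depend on
    [K]. *)
Lemma sum_energy_bounded : exists2 B : R, 0 <= B &
  forall K, exists n0, forall n (G : {set {perm half_edge n d}}), (n0 <= n)%N ->
    swap_closed G -> \sum_(s in G) energy s K <= B * #|G|%:R.
Proof.
pose q := Num.sqrt d%:R / rho.
have q0 : 0 <= q by rewrite divr_ge0 ?sqrtr_ge0 // ltW.
have q1 : q < 1 by rewrite ltr_pdivrMr // mul1r.
have qd : d%:R / rho ^+ 2 = q ^+ 2 by rewrite exprMn exprVn sqr_sqrtr ?ler0n.
have q20 : 0 <= q ^+ 2 by rewrite exprn_ge0.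
have q21 : q ^+ 2 < 1 by rewrite exprn_ilt1 ?q0.
have rj j : 0 < rho ^+ j by rewrite exprn_gt0.
have [B1 B10 B1b] := sum_poly_geom d.*2 q20 q21.
have [B2 B20 B2b] := sum_poly_geom 1 q20 q21.
have [B3 B30 B3b] := sum_poly_geom 1 q0 q1.
pose A : R := (moment_const d 0 * d.+1 ^ d)%:R.
exists (A * B1 + (2 * B2 + B3)).
  by rewrite !addr_ge0 ?mulr_ge0 ?ler0n.
move=> K; exists (\sum_(k < K.+1) excess_const d k).+1 => n G nN Gsw.
have n0 : (0 < n)%N by apply: leq_trans nN.
have nk (k : 'I_K.+1) : (excess_const d k <= n)%N.
  apply: leq_trans (ltnW nN); rewrite (bigD1 k) //=; exact: leq_addr.
have dq j : (d ^ j)%:R / rho ^+ j ^+ 2 = q ^+ 2 ^+ j :> R.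
  by rewrite -qd natrX -exprM mulnC exprM -exprVn -exprMn.
rewrite /energy big_split /= mulrDl; apply: lerD.
  rewrite exchange_big /=.
  apply: (@le_trans _ _ (\sum_(j < n.+1) A * #|G|%:R * (j.+1%:R ^+ d.*2 * q ^+ 2 ^+ j))).
    apply: ler_sum => j _; rewrite -mulr_suml.
    have := sum_elem_sqr Gsw j n0; rewrite -(ler_int R) rmorph_sum /=.
    under eq_bigr do rewrite rmorphXn /=.
    rewrite -(ler_pM2r (_ : 0 < (rho ^+ j ^+ 2)^-1)) ?invr_gt0 ?exprn_gt0 //.
    move/le_trans; apply; rewrite -dq mulrA mulrA ler_wpM2r ?invr_ge0 ?exprn_ge0 ?(ltW rho0) //.
    rewrite -[X in X <= _]/((#|G| * d ^ j * moment_const d j)%:R : R) /A -natrX -!natrM ler_nat.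
    have := leq_mul (leqnn (#|G| * d ^ j)%N) (moment_const_leq d j).
    by move/leq_trans; apply; rewrite leq_eqVlt; apply/orP; left; apply/eqP; ring.
  rewrite -mulr_sumr mulrAC ler_wpM2r ?ler0n // ler_wpM2l ?ler0n //.
rewrite exchange_big /=.
apply: (@le_trans _ _ (\sum_(k < K.+1) #|G|%:R * (2 * (k.+1%:R ^+ 1 * q ^+ 2 ^+ k) +
   k.+1%:R ^+ 1 * q ^+ k))).
  rewrite big_mkcond; apply: ler_sum => k _; rewrite !expr1.
  case: ifP => k0; last by rewrite mulr_ge0 ?addr_ge0 ?mulr_ge0 ?ler0n ?exprn_ge0.
  rewrite big_split /= mulrDr; apply: lerD.
    rewrite -mulr_suml.
    apply: le_trans (ler_wpM2r _ (sum_cycles_variance Gsw n0 d0 R (nk k))) _.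
      by rewrite invr_ge0 !exprn_ge0 // ltW.
    rewrite natrM -mulrA ler_wpM2l ?ler0n // natrM -mulrA dq mulrA.
    rewrite ler_wpM2r ?exprn_ge0 // -natrM ler_nat; lia.
  rewrite -mulr_suml.
  apply: le_trans (ler_wpM2r _ (sum_nonsimple Gsw n0 d0 R k0 (nk k))) _.
    by rewrite invr_ge0 !exprn_ge0 // ltW.
  rewrite natrM -mulrA ler_wpM2l ?ler0n // natrM -mulrA ler_wpM2l ?ler0n //.
  rewrite /q exprMn exprVn ler_wpM2r ?invr_ge0 ?exprn_ge0 ?(ltW rho0) //.
  have sd1 : 1 <= Num.sqrt d%:R :> R by rewrite -[leLHS]sqrtr1 ler_sqrt ?ler1n ?ler0n.
  rewrite natrX -{1}[d%:R](sqr_sqrtr (ler0n R d)) -exprM.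
  by apply: ler_weXn2l => //; rewrite mul2n -geq_half_double.
rewrite -mulr_sumr mulrC ler_wpM2r ?ler0n // big_split /= -mulr_sumr.
apply: lerD; last exact: B3b.
by apply: ler_wpM2l; [exact: ler0n | exact: B2b].
Qed.

End Energy.

Lemma quotient_mx_regular n d (s : {perm half_edge n d}) :
  regular_digraph d (quotient_mx s).
Proof.
apply/andP; split; apply/forallP => j; apply/eqP.
  rewrite (eq_bigr (fun k => \sum_(a < d) ((s (j, a)).1 == k))%N) => [|k _]; last by rewrite mxE.
  rewrite exchange_big /= (eq_bigr (fun=> 1%N)) => [|a _]; first by rewrite sum1_card card_ord.
  by rewrite (bigD1 (s (j, a)).1) //= eqxx big1 // => k; rewrite eq_sym => /negPf ->.
rewrite (eq_bigr (fun k => \sum_(a < d) ((s (k, a)).1 == j))%N) => [|k _]; last by rewrite mxE.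
rewrite pair_big /= (reindex_inj (@perm_inj _ (s^-1)%g)) /=.
under eq_bigr do rewrite -surjective_pairing permKV.
rewrite -(pair_big predT predT (fun k (a : 'I_d) => (k == j : nat))) /=.
rewrite (bigD1 j) //= [X in (_ + X)%N]big1 => [|k /negPf ->]; last by rewrite big1.
by rewrite eqxx sum1_card card_ord addn0.
Qed.

Section EnergyBounds.
Variables (R : realFieldType) (rho L : R) (x : R) (j : nat).
Hypotheses (rho0 : 0 < rho) (L0 : 0 <= L).

Lemma sqr_div_leq : x ^+ 2 / rho ^+ j ^+ 2 <= L ^+ 2 -> `|x| <= L * rho ^+ j.
Proof.
have rj : 0 < rho ^+ j by rewrite exprn_gt0.
rewrite ler_pdivrMr ?exprn_gt0 // -exprMn -real_normK ?num_real //.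
by rewrite ler_pXn2r // nnegrE ?mulr_ge0 // ltW.
Qed.

End EnergyBounds.

Section Gap.
Variables (R : realType) (d : nat) (rho L : R).
Hypotheses (d0 : (0 < d)%N) (rho0 : 0 < rho) (L1 : 1 <= L).
Variables (n : nat) (s : {perm half_edge n d}) (K : nat).
Hypothesis (n0 : (0 < n)%N) (sL : energy rho s K <= L ^+ 2).

Lemma cycles_leq_closed k : (#|cycles s k| <= #|closed_walks s k|)%N.
Proof. by apply/subset_leq_card/subsetP => t; rewrite inE => /andP []. Qed.

Let L0 : 0 <= L. Proof. by rewrite (le_trans ler01). Qed.
Let rj j : 0 <= rho ^+ j. Proof. by rewrite exprn_ge0 // ltW. Qed.

Let term_ge0 j : 0 <= (elem s j)%:~R ^+ 2 / rho ^+ j ^+ 2 :> R.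
Proof. by rewrite divr_ge0 ?sqr_ge0 ?exprn_ge0. Qed.

Let sqr_term_ge0 k : 0 <= (#|cycles s k|%:R - (d ^ k)%:R) ^+ 2 / rho ^+ k ^+ 2 :> R.
Proof. by rewrite divr_ge0 ?sqr_ge0 ?exprn_ge0. Qed.

Let lin_term_ge0 k : 0 <= (#|closed_walks s k|%:R - #|cycles s k|%:R) / rho ^+ k :> R.
Proof. by rewrite divr_ge0 // subr_ge0 ler_nat cycles_leq_closed. Qed.

Lemma elem_energy_leq j : (j <= n)%N -> `|(elem s j)%:~R| <= L * rho ^+ j :> R.
Proof.
move=> jn; apply: sqr_div_leq => //; apply: le_trans sL.
rewrite /energy (bigD1 (Ordinal (jn : (j < n.+1)%N))) //= -addrA lerDl.
by rewrite addr_ge0 // sumr_ge0 // => k _; rewrite addr_ge0.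
Qed.

Lemma closed_walks_energy_leq k : (0 < k <= K)%N ->
  `|#|closed_walks s k|%:R - (d ^ k)%:R| <= (L + L ^+ 2) * rho ^+ k :> R.
Proof.
move=> /andP [k0 kK].
have term : (#|cycles s k|%:R - (d ^ k)%:R) ^+ 2 / rho ^+ k ^+ 2 +
    (#|closed_walks s k|%:R - #|cycles s k|%:R) / rho ^+ k <= L ^+ 2.
  apply: le_trans sL; rewrite /energy [leRHS]addrC.
  rewrite (bigD1 (Ordinal (kK : (k < K.+1)%N))) //= -addrA lerDl.
  by rewrite addr_ge0 // sumr_ge0 // => l _; rewrite addr_ge0.
have rk : 0 < rho ^+ k by rewrite exprn_gt0.
rewrite -[X in `|X|](subrKA #|cycles s k|%:R) mulrDl addrC.
apply: le_trans (ler_normD _ _) _; apply: lerD.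
  by apply: sqr_div_leq => //; apply: le_trans term; rewrite lerDl.
rewrite ger0_norm ?subr_ge0 ?ler_nat ?cycles_leq_closed //.
by rewrite -ler_pdivrMr //; apply: le_trans term; rewrite lerDr.
Qed.

(** Remove the eigenvalue [d] from the spectrum. An element of the rest [r] of modulus above [rho1]
    would have as inverse a root of [recip_poly r], in the disc that [no_root_bound] clears. *)
Lemma energy_gap (rho1 t q : R) (k0 : nat) : rho < d%:R -> 0 < rho1 ->
  1 < t -> L + L ^+ 2 <= (t - 1) *+ k0 -> 0 <= q -> q < 1 -> t * rho <= q * rho1 ->
  (1 + (L + L ^+ 2)) ^+ k0 * (L * rho / (d%:R - rho)) * t / (t - 1) * q ^+ K.+1 / (1 - q) < 1 ->
  ~~ (rho1%:C < `|lambda R (quotient_mx s) 2|).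
Proof.
move=> rhod rho10 t1 Lk q0 q1 tq small; apply/negP => lt.
have reg := quotient_mx_regular s.
have [r E] := eigenvalues_split R reg n0.
have [x xr ltx] : exists2 x, x \in r & rho1%:C < `|x|.
  (* The second eigenvalue is the head of [r], or the default 0 when [r] is empty, which [rho1 > 0]
     excludes. *)
  move: lt; rewrite /lambda E /=; case: (r) => [|x r'] /=.
    by rewrite normr0 ltcR => /(lt_trans rho10); rewrite ltxx.
  by exists x => //; apply: mem_head.
have x0 : 0 < `|x| by apply: le_lt_trans ltx; rewrite lecR ltW.
have charE := char_poly_eigenvalues R (quotient_mx s).
have root0 : (recip_poly r).[x^-1] = 0.
  rewrite horner_prod; apply/eqP; rewrite prodf_seq_eq0; apply/hasP; exists x => //=.
  by rewrite hornerD hornerN hornerZ hornerX hornerC divff ?subrr // -normr_gt0.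
have LL0 : 0 <= L + L ^+ 2 by rewrite addr_ge0 ?exprn_ge0.
have dr0 : 0 < d%:R - rho by rewrite subr_gt0.
have dC : (d%:R : R[i]) = (d%:R : R)%:C by rewrite -(rmorph_nat (real_complex R)).
have toC (z : int) (b : R) : `|z%:~R| <= b -> `|z%:~R : R[i]| <= b%:C.
  by move=> h; rewrite -intr_norm -(rmorph_int (real_complex R)) /= lecR intr_norm.
have := @no_root_bound _ rho%:C (L + L ^+ 2)%:C (L * rho / (d%:R - rho))%:C t%:C q%:C x^-1 K k0 r.
rewrite root0 eqxx => H; suff : ~~ true by []; apply: H => //.
- by rewrite ltcR.
- by rewrite lecR.
- by rewrite lecR divr_ge0 ?mulr_ge0 // ltW.
- by rewrite -(rmorph1 (real_complex R)) ltcR.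
- by rewrite -(rmorph1 (real_complex R)) -rmorphB -rmorphMn /= lecR.
- move=> k kK; rewrite -rmorphXn -rmorphM /=.
  (* The power sum of [r] is the trace minus the contribution [d ^ k] of the removed eigenvalue. *)
  have -> : psum r k = ((#|closed_walks s k|%:Z - (d ^ k)%:Z)%:~R : R[i]).
    have := mxtrace_exp_spectrum k charE; rewrite E /psum big_cons mxtrace_exp.
      by move=> h; rewrite rmorphB /= -!pmulrn natrX [X in X - _]h addrAC subrr add0r.
    by case/andP: kK.
  by apply: toC; rewrite rmorphB /=; apply: closed_walks_energy_leq.
- have -> : (L * rho / (d%:R - rho))%:C = L%:C * rho%:C / (d%:R - rho%:C).
    by rewrite dC -rmorphB -!rmorphM -fmorphV -rmorphM.
  apply: coef_quotient_bound; rewrite ?dC ?ltcR ?lecR //.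
  move=> j; have -> : (1 - d%:R%:C *: 'X) * recip_poly r =
      recip_poly (eigenvalues R (quotient_mx s)).
    by rewrite E /recip_poly big_cons dC.
  rewrite -rmorphXn -rmorphM /=; case: (leqP j n) => jn.
    rewrite coef_recip_poly ?size_eigenvalues // -charE.
    rewrite coef_char_poly_quotient_mx // normrM normrX normrN1 expr1n mul1r.
    by apply: toC; apply: elem_energy_leq.
  rewrite nth_default ?normr0 ?lecR ?mulr_ge0 //.
  by apply: leq_trans (size_recip_poly _) _; rewrite size_eigenvalues.
- by rewrite lecR.
- by rewrite -(rmorph1 (real_complex R)) ltcR.
- rewrite normfV ler_pdivrMr //.
  apply: (@le_trans _ _ (q%:C * rho1%:C)); first by rewrite -!rmorphM lecR.
  by rewrite ler_wpM2l ?ler0c // ltW.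
- move: small; rewrite -ltcR.
  by rewrite !(rmorphM, fmorphV, rmorphXn, rmorphB, rmorphD, rmorph1).
Qed.

End Gap.

Section SpectralGap.
Variables (R : realType) (d : nat) (eps delta : R).
Hypotheses (d0 : (0 < d)%N) (eps0 : 0 < eps) (delta0 : 0 < delta).

Lemma geom_small (c q : R) : 0 <= q -> q < 1 -> 0 <= c ->
  exists K, c * q ^+ K.+1 < 1.
Proof.
move=> q0 q1 c0; have q10 : 0 < 1 - q by rewrite subr_gt0.
have x0 : 0 <= c / (1 - q) by rewrite divr_ge0 // ltW.
exists (Num.bound (c / (1 - q))); have := archi_boundP x0.
set K := Num.bound _ => cK; have k0 : 0 < K.+2%:R :> R by rewrite ltr0n.
rewrite -(ltr_pM2l k0) mulr1 mulrCA.
apply: (@le_lt_trans _ _ (c * (1 - q)^-1)).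
  by rewrite ler_wpM2l // linear_geom_leq.
by apply: lt_trans cK _; rewrite ltr_nat.
Qed.

Lemma energy_nonneg (rho : R) n (s : {perm half_edge n d}) K :
  0 < rho -> 0 <= energy rho s K.
Proof.
move=> rho0; rewrite addr_ge0 // sumr_ge0 // => j _.
  by rewrite divr_ge0 ?sqr_ge0 ?exprn_ge0 // ltW.
rewrite addr_ge0 ?divr_ge0 ?sqr_ge0 ?exprn_ge0 ?(ltW rho0) //.
by rewrite subr_ge0 ler_nat cycles_leq_closed.
Qed.

(** Markov's inequality for the energy. The order of choices matters: [L] from [B] and [delta], then
    [k0] from [L], then [K], and last [n0]. *)
Lemma spectral_gap : exists n0, forall n (G : {set {perm half_edge n d}}),
  (n0 <= n)%N -> swap_closed G ->
  #|[set s in G | (Num.sqrt (d%:R : R) + eps)%:C < `|lambda R (quotient_mx s) 2|]|%:R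
    <= delta * #|G|%:R.
Proof.
set rho1 := Num.sqrt d%:R + eps.
have sd0 : 0 <= Num.sqrt d%:R :> R := sqrtr_ge0 _.
have rho10 : 0 < rho1 by rewrite ltr_wpDl.
(* If [rho1 >= d] the event is empty; otherwise [rho < d], as division by the factor of the
   eigenvalue [d] requires. *)
case: (leP d%:R rho1) => [drho|rhod].
  exists 1 => n G n0 _; rewrite (_ : [set s in G | _] = set0).
    by rewrite cards0 mulr_ge0 // ltW.
  apply/setP => s; rewrite !inE; apply/negbTE; rewrite negb_and; apply/orP; right.
  have [r E] := eigenvalues_split R (quotient_mx_regular s) n0.
  have dC : (d%:R : R[i]) = (d%:R : R)%:C by rewrite -(rmorph_nat (real_complex R)).
  have nE := @norm_eigenvalue_leq R _ _ _ (quotient_mx_regular s); rewrite E in nE.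
  rewrite /lambda E /=; case: r E nE => [|x r] E nE /=.
    by rewrite normr0 ltcR lt_gtF.
  apply/negP => /lt_le_trans /(_ (nE _ _)); rewrite inE mem_head orbT => /(_ isT).
  by rewrite dC ltcR => /lt_le_trans /(_ drho); rewrite ltxx.
pose rho := Num.sqrt d%:R + eps / 2.
have rho0 : 0 < rho by rewrite ltr_wpDl // divr_gt0.
have srho : Num.sqrt d%:R < rho by rewrite ltrDl divr_gt0.
have rr1 : rho < rho1 by rewrite /rho /rho1 ltrD2l ltr_pdivrMr // ltr_pMr // ltr1n.
have rd : rho < d%:R := lt_trans rr1 rhod.
have [B B0 HB] := sum_energy_bounded d0 rho0 srho.
pose L : R := (Num.bound (B / delta)).+1%:R.
have L1 : 1 <= L by rewrite ler1n.
have L0 : 0 <= L by rewrite (le_trans ler01).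
have BL : B <= delta * L ^+ 2.
  rewrite mulrC -ler_pdivrMr //; apply: (@le_trans _ _ L); last by rewrite expr2 ler_peMr.
  apply: ltW; apply: lt_trans (archi_boundP _) _; first by rewrite divr_ge0 // ltW.
  by rewrite ltr_nat.
(* Both [t * rho] and [q * rho1] equal the midpoint of [rho] and [rho1]. *)
pose t := (rho + rho1) / (2 * rho); pose q := (rho + rho1) / (2 * rho1).
have t1 : 1 < t by rewrite ltr_pdivlMr ?mulr_gt0 ?ltr0n // mul1r mulr_natl mulr2n ltrD2l.
have q0 : 0 <= q by apply/ltW/divr_gt0; [exact: addr_gt0 | apply: mulr_gt0; rewrite ?ltr0n].
have q1 : q < 1 by rewrite ltr_pdivrMr ?mulr_gt0 ?ltr0n // mul1r mulr_natl mulr2n ltrD2r.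
have tq : t * rho <= q * rho1.
  by rewrite /t /q !invfM !mulrA !mulfVK ?gt_eqF.
have t10 : 0 < t - 1 by rewrite subr_gt0.
have LL0 : 0 <= L + L ^+ 2 by rewrite addr_ge0 ?exprn_ge0.
pose k0 := Num.bound ((L + L ^+ 2) / (t - 1)).
have Lk : L + L ^+ 2 <= (t - 1) *+ k0.
  rewrite -mulr_natr mulrC -ler_pdivrMr //; apply/ltW/archi_boundP.
  by rewrite divr_ge0 // ltW.
pose c := (1 + (L + L ^+ 2)) ^+ k0 * (L * rho / (d%:R - rho)) * t / (t - 1) / (1 - q).
have c0 : 0 <= c.
  have t0 : 0 <= t by rewrite ltW // (lt_trans ltr01).
  apply: divr_ge0; last by rewrite subr_ge0 ltW.
  apply: divr_ge0; last exact: ltW.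
  apply: mulr_ge0 => //; apply: mulr_ge0; first by apply: exprn_ge0; rewrite addr_ge0.
  by apply: divr_ge0; [apply: mulr_ge0 => //; apply: ltW | rewrite subr_ge0 ltW].
have [K HK] := geom_small q0 q1 c0.
have [n0 Hn] := HB K; exists (maxn n0 1) => n G; rewrite geq_max => /andP [nn0 npos] Gsw.
have L20 : 0 < L ^+ 2 by rewrite exprn_gt0 // (lt_le_trans ltr01).
rewrite -(ler_pM2r L20) mulrAC.
apply: (@le_trans _ _ (B * #|G|%:R)); last by rewrite ler_wpM2r.
apply: le_trans (Hn n G nn0 Gsw); set A := [set s in G | _].
apply: (@le_trans _ _ (\sum_(s in A) energy rho s K)).
  rewrite mulr_natl -sumr_const; apply: ler_sum => s; rewrite inE => /andP [_ lt].
  rewrite leNgt; apply/negP => sL; move: lt; apply/negP.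
  apply: (energy_gap rho0 L1 npos (ltW sL) rd rho10 t1 Lk q0 q1 tq).
  by rewrite -/c in HK *; move: HK; rewrite /c -!mulrA [(1 - q)^-1 * _]mulrC.
rewrite [leRHS](bigID (mem A)) /= (eq_bigl (fun s => (s \in G) && (s \in A))).
  by rewrite lerDl sumr_ge0 // => s _; apply: energy_nonneg.
by move=> s; rewrite inE; case: (s \in G).
Qed.

End SpectralGap.

(** * Probability of being simple *)

Section Simple.
Variables n d : nat.
Local Notation X := (half_edge n d).
Implicit Types (s : {perm X}) (x y z w : X).
Local Open Scope nat_scope.

Definition parallel s x y := [&& y != x, y.1 == x.1 & (s y).1 == (s x).1].

Definition parallels s : {set X} := [set x | [exists y, parallel s x y]].

Lemma parallels0_simple s : parallels s = set0 -> simple_digraph (quotient_mx s).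
Proof.
move=> s0; apply/forallP => j; apply/forallP => l; rewrite mxE.
rewrite (_ : \sum_(a < d) _ = #|[set a : 'I_d | (s (j, a)).1 == l]|); last first.
  by rewrite -sum1_card [RHS]big_mkcond; apply: eq_bigr => a _; rewrite inE; case: eqP.
rewrite leqNgt; apply/negP => /card_gt1P [a [b []]]; rewrite !inE => /eqP al /eqP bl ab.
have : (j, a) \in parallels s; last by rewrite s0 inE.
rewrite inE; apply/existsP; exists (j, b); rewrite /parallel /= al bl !eqxx !andbT.
by apply: contra ab => /eqP [->].
Qed.

Lemma card_heads s (v : 'I_n) : #|[set x | (s x).1 == v]| = d.
Proof.
rewrite -(card_imset _ (@perm_inj _ s)).
rewrite -[RHS](card_ord d) -[RHS](card_imset predT (f := fun a : 'I_d => (v, a))).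
  2: by move=> a b [].
apply: eq_card => x; apply/imsetP/imsetP => [[y + ->]|[a _ ->]].
  rewrite inE => /eqP <-; exists (s y).2 => //; exact: surjective_pairing.
by exists (s^-1 (v, a))%g; rewrite ?inE permKV /=.
Qed.

Lemma card_fiber (v : 'I_n) : #|[set x : X | x.1 == v]| = d.
Proof. by rewrite -[RHS](card_heads 1%g v); apply: eq_card => x; rewrite !inE perm1. Qed.

Variable G : {set {perm X}}.
Hypothesis Gsw : swap_closed G.

(** For [n * d] half-edges, at most [d] partners at the same vertex and [n] common heads, the
    probability is at most [(2 / n) ^ 2]. *)
Lemma sum_card_parallels : \sum_(s in G) #|parallels s| <= 4 * d ^ 2 * #|G|.
Proof.
case: (posnP n) => [n0|n0].
  rewrite big1 // => s _; apply: eq_card0 => -[[j jn] a].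
  by have := leq_ltn_trans (leq0n j) jn; lia.
have n20 : 0 < n ^ 2 by rewrite expn_gt0 n0.
rewrite -(leq_pmul2r n20).
pose N x y v := nb_meeting G [:: (x, v); (y, v)].
apply: (@leq_trans ((\sum_x \sum_(y | (y != x) && (y.1 == x.1)) \sum_v N x y v) * n ^ 2)).
  rewrite leq_mul2r; apply/orP; right.
  under eq_bigr => s _ do rewrite -sum1_card big_mkcond.
  rewrite exchange_big; apply: leq_sum => x _ /=.
  under [leqRHS]eq_bigr => y _.
    under eq_bigr => v _ do rewrite /N /nb_meeting -sum1_card big_mkcond.
    rewrite exchange_big; over.
  rewrite exchange_big [leqRHS]/= big_mkcond; apply: leq_sum => s _.
  case: ifP => // sG; case: ifP => //; rewrite inE => /existsP [y /and3P [yx y1 sy]].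
  rewrite (bigD1 y) ?yx ?y1 //= (bigD1 (s x).1) //=.
  by rewrite inE sG /= eqxx sy.
rewrite big_distrl /=.
apply: (@leq_trans (\sum_(x : X) d * n * (4 * #|G|))); last first.
  rewrite sum_nat_const card_prod !card_ord leq_eqVlt; apply/orP; left; apply/eqP.
  by ring.
apply: leq_sum => x _; rewrite big_distrl /=.
apply: (@leq_trans (\sum_(y | (y != x) && (y.1 == x.1)) n * (4 * #|G|))).
  apply: leq_sum => y /andP [yx _].
  rewrite big_distrl -[X in X * (4 * _)](card_ord n) -sum_nat_const.
  apply: leq_sum => v _; have := @nb_meeting_cat_ffact _ _ _ Gsw [:: (x, v); (y, v)] [::].
  rewrite cats0 nb_meeting_nil /= inE eq_sym yx mulnC [leqRHS]mulnC => -> //.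
rewrite sum_nat_const mulnA leq_mul2r leq_mul2r; apply/orP; right; apply/orP; right.
rewrite -[leqRHS](card_fiber x.1); apply/subset_leq_card/subsetP => y.
by rewrite -topredE /= inE => /andP [].
Qed.

(** Ensures that exchanging the heads of [x] and [(l, x.2)] creates no parallel pair at either
    vertex. *)
Definition good_swap s x (l : 'I_n) :=
  [&& l != x.1, [forall y, (y.1 == x.1) ==> ((s (l, x.2)).1 != (s y).1)] &
   [forall y, (y.1 == l) ==> ((s x).1 != (s y).1)]].

Lemma card_good_swap s x : n <= #|[set l | good_swap s x l]| + (d * d + d).+1.
Proof.
(* Bad vertices carry a half-edge sharing its head vertex with one out of [x.1] ([B1]) or with [x]
   itself ([B2]); each vertex is the head of exactly [d] half-edges. *)
pose B1 : {set 'I_n} := \bigcup_(b : 'I_d) [set y.1 | y in [set y | (s y).1 == (s (x.1, b)).1]].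
pose B2 : {set 'I_n} := [set y.1 | y in [set y | (s y).1 == (s x).1]].
have c1 : #|B1| <= d * d.
  apply: (@leq_trans (\sum_(b < d) d)); last by rewrite sum_nat_const card_ord.
  rewrite /B1; elim/big_rec2: _ => [|b m A _ le]; first by rewrite cards0.
  apply: leq_trans (leq_card_setU _ _) _; rewrite leq_add //.
  by apply: leq_trans (leq_imset_card _ _) _; rewrite card_heads.
have c2 : #|B2| <= d.
  by apply: leq_trans (leq_imset_card _ _) _; rewrite card_heads.
rewrite -[leqLHS](card_ord n) -cardsT.
apply: (@leq_trans #|[set l | good_swap s x l] :|: (x.1 |: (B1 :|: B2))|); last first.
  apply: leq_trans (leq_card_setU _ _) _; rewrite leq_add2l.
  rewrite cardsU1; apply: leq_trans (leq_add (leq_b1 _) (leq_card_setU _ _)) _.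
  by rewrite add1n ltnS leq_add.
apply/subset_leq_card/subsetP => l _.
rewrite !in_setU [l \in [set _ | _]]inE in_set1 /good_swap.
case: (eqVneq l x.1) => //= lx.
case: (boolP [forall y, _]) => [_|/forallPn [y]] /=; last first.
  rewrite negb_imply negbK => /andP [/eqP y1 /eqP e].
  apply/orP; left; apply/bigcupP; exists y.2 => //.
  by apply/imsetP; exists (l, x.2); rewrite // inE -y1 -surjective_pairing e.
case: (boolP [forall y, _]) => [_|/forallPn [y]] //=.
rewrite negb_imply negbK => /andP [/eqP y1 /eqP e].
by apply/orP; right; apply/imsetP; exists y; rewrite ?inE ?e // y1.
Qed.

Definition swap_tail x (l : 'I_n) s : {perm X} := (relabel x.2 x.1 l * s)%g.

Lemma swap_tailL x l s : swap_tail x l s x = s (l, x.2).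
Proof. by rewrite permM /relabel -surjective_pairing tpermL. Qed.

Lemma swap_tailR x l s : swap_tail x l s (l, x.2) = s x.
Proof. by rewrite permM /relabel -surjective_pairing tpermR. Qed.

Lemma swap_tailD x l s y : y != x -> y != (l, x.2) -> swap_tail x l s y = s y.
Proof. by move=> yx yz; rewrite permM /relabel -surjective_pairing tpermD // eq_sym. Qed.

Lemma parallels_swap s x l : x \in parallels s -> good_swap s x l ->
  #|parallels (swap_tail x l s)| < #|parallels s|.
Proof.
move=> xs /and3P [lx /forallP g1 /forallP g2].
have {}g1 y : y.1 = x.1 -> (s (l, x.2)).1 <> (s y).1.
  by move=> y1; apply/eqP; apply: (implyP (g1 y)); rewrite y1.
have {}g2 y : y.1 = l -> (s x).1 <> (s y).1.
  by move=> y1; apply/eqP; apply: (implyP (g2 y)); rewrite y1.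
apply: proper_card; apply/properP; split; last first.
  exists x => //; rewrite inE; apply/existsP => -[w /and3P [wx /eqP w1]].
  rewrite swap_tailL swap_tailD //; last first.
    by apply: contra lx => /eqP wl; rewrite -w1 wl.
  by move/eqP/esym; apply: g1.
apply/subsetP => y; rewrite !inE => /existsP [w /and3P [wy /eqP w1]].
case: (eqVneq y x) wy w1 => [->|yx] wy w1.
  rewrite swap_tailL swap_tailD //; first by move/eqP/esym => /g1 [].
  by apply: contra lx => /eqP wl; rewrite -w1 wl.
case: (eqVneq y (l, x.2)) wy w1 => [->|yz] wy w1.
  rewrite swap_tailR swap_tailD //; first by move/eqP/esym => /g2 [].
  by apply: contra lx => /eqP wl; rewrite -wl w1.
rewrite [swap_tail x l s y]swap_tailD //.
case: (eqVneq w x) wy w1 => [->|wx] wy w1; first by rewrite swap_tailL => /eqP /g1 [].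
case: (eqVneq w (l, x.2)) wy w1 => [->|wz] wy w1; first by rewrite swap_tailR => /eqP /g2 [].
by rewrite swap_tailD // => sw; apply/existsP; exists w; rewrite /parallel wy w1 eqxx.
Qed.

(** The trace left by a switching: [(l, x.2)] now points to the vertex where a former partner of [x]
    points. It bounds the number of swaps leading to a given permutation. *)
Definition reversal s (p : X * 'I_n) :=
  [exists y, (y.1 == p.1.1) && ((s (p.2, p.1.2)).1 == (s y).1)].

Lemma reversal_swap s x l : l != x.1 -> x \in parallels s ->
  reversal (swap_tail x l s) (x, l).
Proof.
move=> lx; rewrite inE => /existsP [y /and3P [yx y1 sy]].
apply/existsP; exists y; rewrite y1 /= swap_tailR swap_tailD //; first by rewrite eq_sym.
by apply: contra lx => /eqP yl; rewrite -(eqP y1) yl.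
Qed.

(** There are [n * d] choices of [x], [d] of the partner, and [d] of a half-edge with the same head
    vertex as the partner. *)
Lemma card_reversal s : #|[set p | reversal s p]| <= n * d ^ 3.
Proof.
pose F (q : X * 'I_d) := [set (q.1, z.1) | z in [set z | (s z).1 == (s (q.1.1, q.2)).1]].
apply: (@leq_trans #|\bigcup_q F q|).
  apply/subset_leq_card/subsetP => -[x l]; rewrite inE => /existsP [y /andP [/eqP y1 sy]].
  apply/bigcupP; exists (x, y.2) => //; apply/imsetP; exists (l, x.2) => //.
  by rewrite inE -y1 -surjective_pairing.
apply: (@leq_trans (\sum_(q : X * 'I_d) d)); last first.
  rewrite sum_nat_const !card_prod !card_ord leq_eqVlt; apply/orP; left; apply/eqP; ring.
elim/big_rec2: _ => [|q m A _ le]; first by rewrite cards0.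
apply: leq_trans (leq_card_setU _ _) _; rewrite leq_add //.
by apply: leq_trans (leq_imset_card _ _) _; rewrite card_heads.
Qed.

Definition few k := [set s in G | #|parallels s| <= k].

(* Switching: swapping the heads of a parallel half-edge and of a generic
   half-edge with the same label destroys parallel half-edges, and few swaps
   lead to a given permutation. *)
Lemma card_few_step k :
  #|few k.+1 :\: few k| * (n - (d * d + d).+1) <= #|few k| * (n * d ^ 3).
Proof.
pose P := [set p : {perm X} * (X * 'I_n) | [&& p.1 \in few k.+1 :\: few k,
   p.2.1 \in parallels p.1 & good_swap p.1 p.2.1 p.2.2]].
pose h (p : {perm X} * (X * 'I_n)) := (swap_tail p.2.1 p.2.2 p.1, p.2).
have hinj : injective h.
  move=> [s p] [t p'] E; have pE : p = p' by apply: (congr1 snd E).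
  by have := congr1 fst E; rewrite /= -pE /swap_tail => /mulgI ->.
apply: (@leq_trans #|P|).
  rewrite -sum_nat_const; apply: (@leq_trans (\sum_(s in few k.+1 :\: few k)
     #|[set p : X * 'I_n | (p.1 \in parallels s) && good_swap s p.1 p.2]|)).
    apply: leq_sum => s; rewrite !inE negb_and => /andP [/orP [/negP sG|lt] /andP [sG' _]] //.
    have [x xs] : exists x, x \in parallels s.
      by apply/card_gt0P; rewrite (leq_trans _ (_ : k < _)) // ltnNge.
    rewrite leq_subLR addnC; apply: leq_trans (card_good_swap s x) _.
    rewrite leq_add2r -(card_imset _ (_ : injective (pair x))); last by move=> ? ? [].
    apply/subset_leq_card/subsetP => _ /imsetP [l + ->]; rewrite !inE => ->.
    by rewrite andbT; move: xs; rewrite inE.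
  rewrite leq_eqVlt; apply/orP; left; apply/eqP.
  rewrite -[RHS]sum1_card [RHS](partition_big fst
    (fun s => s \in few k.+1 :\: few k)) /=; last first.
    by move=> p; rewrite inE => /and3P [].
  apply: eq_bigr => s sF; rewrite -(card_imset _ (_ : injective (pair s))); last by move=> ? ? [].
  rewrite -sum1_card; apply: eq_bigl => -[t p]; rewrite [in RHS]inE /=.
  apply/imsetP/idP => [[q + [-> ->]]|]; first by rewrite inE sF eqxx => ->.
  by move=> /andP [/and3P [_ px gp] /eqP <-]; exists p => //; rewrite in_set px.
rewrite -(card_imset _ hinj).
apply: (@leq_trans #|[set p | (p.1 \in few k) && reversal p.1 p.2]|).
  apply/subset_leq_card/subsetP => _ /imsetP [[s [x l]] + ->].
  rewrite [in X in X -> _]inE /= => /and3P [/setDP [+ _] xs gs]; rewrite !inE => /andP [sG sk].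
  rewrite (reversal_swap _ xs) ?andbT; last by case/and3P: gs.
  rewrite -ltnS (leq_trans (parallels_swap xs gs) sk) andbT.
  by case/andP: (Gsw x.2 x.1 l sG).
rewrite -sum1_card (partition_big fst (mem (few k))) /=; last first.
  by move=> p; rewrite inE => /andP [].
rewrite -sum_nat_const; apply: leq_sum => s _; apply: leq_trans (card_reversal s).
rewrite sum1_card -(card_imset [set p | _] (_ : injective (pair s))); last by move=> ? ? [].
apply/subset_leq_card/subsetP => -[t p]; rewrite -topredE /= inE /= => /andP [/andP [_ r] /eqP ts].
by apply/imsetP; exists p; rewrite ?inE ?ts // -ts.
Qed.

(** By Markov's inequality, at least half of [G] has at most [8 * d ^ 2] parallel half-edges. Each
    switching step then lowers this bound by one at the cost of a factor [1 + 2 * d ^ 3], since at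
    least half of the vertices give good swaps. *)
Lemma card_simple_geq : 2 * (d * d + d).+1 <= n ->
  #|G| <= 2 * (1 + 2 * d ^ 3) ^ (8 * d ^ 2) *
    #|[set s in G | simple_digraph (quotient_mx s)]|.
Proof.
move=> nd.
have step k : #|few k| <= (1 + 2 * d ^ 3) ^ k * #|few 0|.
  elim: k => [|k IH]; first by rewrite expn0 mul1n.
  rewrite expnS -mulnA; apply: leq_trans (leq_mul (leqnn _) IH).
  rewrite -(cardsID (few k) (few k.+1)) mulnDl mul1n leq_add //.
    exact/subset_leq_card/subsetIr.
  have npos : 0 < n - (d * d + d).+1 by lia.
  rewrite -(leq_pmul2r npos); apply: leq_trans (card_few_step k) _.
  rewrite mulnC [leqRHS]mulnAC leq_mul2r; apply/orP; right.
  by rewrite mulnC -mulnA mulnCA leq_mul2l; apply/orP; right; lia.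
have half : #|G| <= 2 * #|few (8 * d ^ 2)|.
  have mk : #|G :\: few (8 * d ^ 2)| * (8 * d ^ 2).+1 <= 4 * d ^ 2 * #|G|.
    apply: leq_trans sum_card_parallels; rewrite -sum_nat_const.
    rewrite [leqRHS](bigID (mem (G :\: few (8 * d ^ 2)))) /=.
    apply: leq_trans (leq_addr _ _).
    rewrite [leqRHS](eq_bigl (fun s => s \in G :\: few (8 * d ^ 2))); last first.
      by move=> s; rewrite !inE; case: (s \in G); rewrite ?andbF.
    apply: leq_sum => s; rewrite !inE negb_and => /andP [/orP [/negP //|]].
    by rewrite -ltnNge.
  have := cardsID (few (8 * d ^ 2)) G.
  have : #|G :&: few (8 * d ^ 2)| <= #|few (8 * d ^ 2)| by apply/subset_leq_card/subsetIr.
  move: mk; move: #|G| #|few _| #|_ :&: _| #|_ :\: _| => g f a b.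
  nia.
apply: leq_trans half _; rewrite -mulnA leq_mul2l /=.
apply: leq_trans (step _) _; rewrite leq_mul2l; apply/orP; right.
apply/subset_leq_card/subsetP => s; rewrite !inE leqn0 => /andP [-> /eqP s0] /=.
by apply: parallels0_simple; apply/eqP; rewrite -cards_eq0 s0.
Qed.

End Simple.

(** * The three models *)

Section LabelPreserving.
Variables n d : nat.
Local Notation X := (half_edge n d).
Implicit Types (t : {ffun 'I_d -> 'S_n}) (s : {perm X}).

Definition label_preserving : {set {perm X}} := [set s : {perm X} | [forall x : X, (s x).2 == x.2]].

Lemma label_preserving_swap_closed : swap_closed label_preserving.
Proof.
move=> s a u v; rewrite !inE => /forallP sl.
have rl x : (relabel a u v x).2 = x.2.
  by rewrite /relabel; case: tpermP => // ->.
by apply/andP; split; apply/forallP => x; rewrite permM ?rl ?(eqP (sl _)) ?rl.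
Qed.

Lemma setT_swap_closed : swap_closed [set: {perm X}].
Proof. by move=> s a u v; rewrite !inE. Qed.

Fact glue_subproof t : injective (fun x : X => (t x.2 x.1, x.2)).
Proof. by move=> [j a] [l b] /= [+ ab]; rewrite ab => /perm_inj ->. Qed.

Definition glue t : {perm X} := perm (@glue_subproof t).

Lemma quotient_mx_glue t : quotient_mx (glue t) = perm_sum t.
Proof.
apply/matrixP => j l; rewrite !mxE summxE; apply: eq_bigr => a _.
by rewrite permE !mxE /=; case: eqP.
Qed.

Lemma glue_inj : injective glue.
Proof.
move=> t t' /permP e; apply/ffunP => a; apply/permP => j.
by have := e (j, a); rewrite !permE /= => -[].
Qed.

Lemma imset_glue : [set glue t | t in [set: {ffun 'I_d -> 'S_n}]] = label_preserving.
Proof.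
apply/setP => s; rewrite inE; apply/imsetP/forallP => [[t _ ->] x|sl].
  by rewrite permE.
have inj a : injective (fun j : 'I_n => (s (j, a)).1).
  move=> j l e; have : s (j, a) = s (l, a).
    by apply: injective_projections; rewrite ?e // (eqP (sl (j, a))) (eqP (sl (l, a))).
  by move/perm_inj => [].
exists [ffun a => perm (inj a)] => //; apply/permP => -[j a].
rewrite permE /= ffunE permE /= [LHS]surjective_pairing.
by rewrite (eqP (sl (j, a))).
Qed.

Lemma card_perm_sum (E : pred 'M[nat]_n) :
  #|[set t in [set: {ffun 'I_d -> 'S_n}] | E (perm_sum t)]| =
  #|[set s in label_preserving | E (quotient_mx s)]|.
Proof.
rewrite -(card_imset _ glue_inj); apply: eq_card => s; rewrite inE.
apply/imsetP/andP => [[t + ->]|[]].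
  rewrite !inE quotient_mx_glue /= => ->; split=> //.
  by apply/forallP => x; rewrite permE.
rewrite -imset_glue => /imsetP [t _ ->]; rewrite quotient_mx_glue => Et.
by exists t; rewrite // !inE.
Qed.

End LabelPreserving.

(** * Fibres of the configuration model over simple digraphs *)

Section Fibers.
Variables n d : nat.
Local Notation X := (half_edge n d).
Variable B : 'M[bool]_n.
Hypothesis Breg : regular_digraph d (adjacency B).
Local Open Scope nat_scope.

Lemma card_out (j : 'I_n) : #|[pred l | B j l]| = d.
Proof.
case/andP: Breg => /forallP /(_ j) /eqP <- _.
by rewrite -sum1_card big_mkcond; apply: eq_bigr => l _; rewrite !mxE inE; case: (B j l).
Qed.

Lemma card_in (l : 'I_n) : #|[pred j | B j l]| = d.
Proof.
case/andP: Breg => _ /forallP /(_ l) /eqP <-.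
by rewrite -sum1_card big_mkcond; apply: eq_bigr => j _; rewrite !mxE inE; case: (B j l).
Qed.

Definition labelings (r : 'I_n -> pred 'I_n) : {set {ffun 'I_n -> {ffun 'I_d -> 'I_n}}} :=
  [set f in family (fun j => [set g : {ffun 'I_d -> 'I_n} | g \in ffun_on (r j) & injectiveb g])].

Lemma card_labelings (r : 'I_n -> pred 'I_n) : (forall j, #|r j| = d) ->
  #|labelings r| = d`! ^ n.
Proof.
move=> rd; rewrite cardsE card_family.
rewrite /image_mem (eq_map (g := fun=> d`!)) => [|j]; last first.
  by rewrite card_inj_ffuns_on rd card_ord ffactnn.
have gen (e : seq 'I_n) : foldr muln 1 [seq d`! | _ <- e] = d`! ^ size e.
  by elim: e => //= _ e ->; rewrite expnS.
by rewrite gen -cardE card_ord.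
Qed.

Lemma labelingsP (r : 'I_n -> pred 'I_n) (f : {ffun 'I_n -> {ffun 'I_d -> 'I_n}}) :
  reflect (forall j, injective (f j) /\ forall a, r j (f j a)) (f \in labelings r).
Proof.
rewrite inE; apply: (iffP familyP) => h j.
  by have := h j; rewrite inE => /andP [/ffun_onP fr /injectiveP].
by have [inj fr] := h j; rewrite inE; apply/andP; split; [apply/ffun_onP | apply/injectiveP].
Qed.

Lemma labelings_onto (r : 'I_n -> pred 'I_n)
    (f : {ffun 'I_n -> {ffun 'I_d -> 'I_n}}) j l : (forall j, #|r j| = d) ->
  f \in labelings r -> r j l -> exists a, f j a = l.
Proof.
move=> rd /labelingsP /(_ j) [inj fr] rl.
have : #|[set f j a | a : 'I_d]| = #|[set l | r j l]|.
  by rewrite card_imset // card_ord cardsE rd.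
have sub : [set f j a | a : 'I_d] \subset [set l | r j l].
  by apply/subsetP => _ /imsetP [a _ ->]; rewrite inE.
move/eqP; rewrite (subset_leqif_card sub) => /subsetP /(_ l); rewrite inE => /(_ rl).
by case/imsetP => a _ ->; exists a.
Qed.

Let rout (j : 'I_n) : pred 'I_n := [pred l | B j l].
Let rin (l : 'I_n) : pred 'I_n := [pred j | B j l].

Definition ends (s : {perm X}) :=
  ([ffun j => [ffun a => (s (j, a)).1]] : {ffun 'I_n -> {ffun 'I_d -> 'I_n}},
   [ffun l => [ffun b => ((s^-1)%g (l, b)).1]] : {ffun 'I_n -> {ffun 'I_d -> 'I_n}}).

(** A preimage amounts to a numbering of the out-neighbours and of the in-neighbours of each vertex:
    [s (j, a) = (l, b)] when [l] is the [a]-th out-neighbour of [j] and [j] the [b]-th in-neighbour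
    of [l]. Entries at most 1 make [b] unique, and the count does not depend on [B]. *)
Lemma card_quotient_fiber :
  #|[set s : {perm X} | quotient_mx s == adjacency B]| = d`! ^ n * d`! ^ n.
Proof.
have qE (s : {perm X}) j l : quotient_mx s j l = #|[set a | (s (j, a)).1 == l]|.
  rewrite mxE -sum1_card [RHS]big_mkcond; apply: eq_bigr => a _.
  by rewrite inE; case: eqP.
have toB (s : {perm X}) j a : quotient_mx s == adjacency B -> B j (s (j, a)).1.
  move/eqP/matrixP/(_ j (s (j, a)).1); rewrite qE [RHS]mxE.
  by case: (B _ _) => // /card0_eq /(_ a); rewrite !inE eqxx.
have once (s : {perm X}) j a b : quotient_mx s == adjacency B ->
    (s (j, a)).1 = (s (j, b)).1 -> a = b.
  move/eqP/matrixP/(_ j (s (j, a)).1); rewrite qE [RHS]mxE => le ab.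
  have /card_le1_eqP : #|[set c | (s (j, c)).1 == (s (j, a)).1]| <= 1.
    by rewrite le leq_b1.
  by apply; rewrite inE ?ab.
rewrite -{1}(card_labelings (r := rout) card_out) -(card_labelings (r := rin) card_in).
rewrite -cardsX -(@card_in_imset _ _ ends); last first.
  move=> s t; rewrite !inE => sB tB [/ffunP e1 /ffunP e2].
  have {}e1 j a : (s (j, a)).1 = (t (j, a)).1.
    by have /ffunP /(_ a) := e1 j; rewrite !ffunE.
  have {}e2 l b : ((s^-1)%g (l, b)).1 = ((t^-1)%g (l, b)).1.
    by have /ffunP /(_ b) := e2 l; rewrite !ffunE.
  apply/permP => -[j a]; set l := (s (j, a)).1; set b := (s (j, a)).2.
  have sE : (s^-1)%g (l, b) = (j, a) by rewrite -surjective_pairing permK.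
  have tj : ((t^-1)%g (l, b)).1 = j by rewrite -e2 sE.
  have tE : (t^-1)%g (l, b) = (j, a).
    rewrite [LHS]surjective_pairing tj; congr (_, _).
    have tX : t (j, ((t^-1)%g (l, b)).2) = (l, b).
      by rewrite -[X in t (X, _)]tj -surjective_pairing permKV.
    by apply: (once t j) => //; rewrite tX -e1.
  by rewrite [LHS]surjective_pairing -/l -/b -tE permKV.
apply: eq_card => -[f g]; rewrite inE; apply/imsetP/andP => [[s]|[/= fB gB]].
  rewrite inE => sB [-> ->]; split; apply/labelingsP => j; split.
  - by move=> a b; rewrite !ffunE; apply: once.
  - by move=> a; rewrite !ffunE; apply: toB.
  - move=> a b; rewrite !ffunE => e.
    have sE c : s (((s^-1)%g (j, c)).1, ((s^-1)%g (j, c)).2) = (j, c).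
      by rewrite -surjective_pairing permKV.
    have e2 : ((s^-1)%g (j, a)).2 = ((s^-1)%g (j, b)).2.
      by apply: (once s ((s^-1)%g (j, a)).1) => //; rewrite sE e sE.
    by have := sE a; rewrite e e2 sE => -[].
  - move=> b; rewrite !ffunE /rin /=.
    have := toB s ((s^-1)%g (j, b)).1 ((s^-1)%g (j, b)).2 sB.
    by rewrite -surjective_pairing permKV.
have /labelingsP fP := fB; have /labelingsP gP := gB.
have ex (x : X) : [exists b, g (f x.1 x.2) b == x.1].
  have [_ /(_ x.2) fr] := fP x.1.
  have [b bE] := labelings_onto card_in gB (fr : rin (f x.1 x.2) x.1).
  by apply/existsP; exists b; rewrite bE.
pose lab (x : X) := xchoose (existsP (ex x)).
have labE x : g (f x.1 x.2) (lab x) = x.1.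
  by apply/eqP; exact: (xchooseP (existsP (ex x))).
have inj : injective (fun x : X => (f x.1 x.2, lab x)).
  move=> x y [e1 e2]; have x1 : x.1 = y.1 by rewrite -labE -[RHS]labE e1 e2.
  apply: injective_projections => //; rewrite x1 in e1.
  by have [fi _] := fP y.1; apply: fi.
exists (perm inj).
  rewrite inE; apply/eqP/matrixP => j l; rewrite qE mxE.
  have fE : [set a | (perm inj (j, a)).1 == l] = [set a | f j a == l].
    by apply/setP => a; rewrite !inE permE.
  rewrite fE; have [fi fr] := fP j; case: (boolP (B j l)) => Bjl.
    have [a <-] := labelings_onto card_out fB (Bjl : rout j l).
    transitivity #|[set a]|; last by rewrite cards1.
    by apply: eq_card => b; rewrite !inE (inj_eq fi).
  by apply: eq_card0 => a; rewrite !inE; apply: contraNF Bjl => /eqP <-; apply: fr.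
congr (_, _); apply/ffunP => j; rewrite ffunE; apply/ffunP => a; rewrite ffunE.
  by rewrite permE.
have [gi gr] := gP j.
have [c cE] := labelings_onto card_out fB (gr a : rout (g j a) j).
have sE : perm inj (g j a, c) = (j, a).
  rewrite permE /= cE; congr (_, _); apply: gi; rewrite -{1}cE.
  exact: (labE (g j a, c)).
by rewrite -sE permK.
Qed.

End Fibers.

Section Models.
Variables (n d : nat).
Local Notation X := (half_edge n d).

(** The circulant digraph: the shifts by [0, ..., d - 1] modulo [n] are pairwise disjoint when
    [d <= n]. *)
Lemma exists_simple_perm_sum : (0 < d)%N -> (d <= n)%N ->
  exists t : {ffun 'I_d -> 'S_n}, simple_digraph (perm_sum t).
Proof.
move=> d0; case: n => [|k] dn; first by move: d0; rewrite ltnNge dn.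
exists [ffun a : 'I_d => perm (@addIr _ (widen_ord dn a))].
apply/forallP => j; apply/forallP => l; rewrite summxE.
rewrite (eq_bigr (fun a : 'I_d => (j + widen_ord dn a == l : nat))) => [|a _]; last first.
  by rewrite !mxE ffunE permE /=; case: eqP.
case: (pickP (fun a : 'I_d => j + widen_ord dn a == l)) => [a al|no]; last first.
  by rewrite big1 // => a _; rewrite no.
rewrite (bigD1 a) //= al big1 // => b ba; move: al; rewrite eq_sym => /eqP ->.
by rewrite (inj_eq (addrI j)) -val_eqE /= val_eqE (negPf ba).
Qed.

Definition family_of (m : model) : {set {perm X}} :=
  if m is RegularDigraph then setT else label_preserving n d.

Definition conditioned (m : model) (A : 'M[nat]_n) : bool :=
  if m is PermSum then true else simple_digraph A.

Lemma family_of_swap_closed m : swap_closed (family_of m).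
Proof.
by case: m; [exact: label_preserving_swap_closed
  | exact: label_preserving_swap_closed | exact: setT_swap_closed].
Qed.

Lemma simple_adjacency (A : 'M[nat]_n) : simple_digraph A ->
  adjacency (map_mx (fun k => k == 1%N) A) = A.
Proof.
move=> /forallP sA; apply/matrixP => j l; rewrite !mxE.
by have /forallP /(_ l) := sA j; case: (A j l) => [|[]].
Qed.

Lemma adjacency_inj : injective (@adjacency n).
Proof.
move=> B B' /matrixP e; apply/matrixP => j l; have := e j l; rewrite !mxE.
by case: (B j l) (B' j l) => [] [].
Qed.

Lemma adjacency_simple (B : 'M[bool]_n) : simple_digraph (adjacency B).
Proof. by apply/forallP => j; apply/forallP => l; rewrite mxE leq_b1. Qed.

(* The configuration model conditioned on simplicity is uniform, since every
   regular 0/1 matrix has the same number of preimages. *)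
Lemma card_regular (E : pred 'M[nat]_n) :
  (#|[set B in [set B : 'M[bool]_n | regular_digraph d (adjacency B)] | E (adjacency B)]|
    * (d`! ^ n * d`! ^ n))%N =
  #|[set s : {perm X} | simple_digraph (quotient_mx s) && E (quotient_mx s)]|.
Proof.
pose inv (s : {perm X}) : 'M[bool]_n := map_mx (fun k => k == 1%N) (quotient_mx s).
rewrite -[RHS]sum1_card (partition_big inv (fun B => B \in
  [set B in [set B : 'M[bool]_n | regular_digraph d (adjacency B)] | E (adjacency B)])); last first.
  move=> s; rewrite !inE => /andP [ss Es].
  by rewrite /inv simple_adjacency // quotient_mx_regular.
rewrite -sum_nat_const; apply: eq_bigr => B; rewrite !inE => /andP [Breg EB].
rewrite -(card_quotient_fiber Breg) -sum1_card; apply: eq_bigl => s; rewrite !inE.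
apply/eqP/andP => [sB|[/andP [ss _] /eqP <-]]; last by rewrite /inv simple_adjacency.
rewrite sB adjacency_simple EB; split=> //; apply/eqP/adjacency_inj.
by rewrite /inv sB simple_adjacency // adjacency_simple.
Qed.

Lemma model_prE (R : realType) (m : model) (E : pred 'M[nat]_n) :
  model_pr R m d n E =
  #|[set s in family_of m | conditioned m (quotient_mx s) && E (quotient_mx s)]|%:R /
  #|[set s in family_of m | conditioned m (quotient_mx s)]|%:R.
Proof.
case: m => /=; rewrite /uniform_cond_pr /uniform_pr.
- rewrite (@card_perm_sum n d E); congr (_%:R / _%:R).
  rewrite -(card_imset _ (@glue_inj n d)) imset_glue; apply: eq_card => s.
  by rewrite !inE andbT.
- rewrite (@card_perm_sum n d (predI E (@simple_digraph n))).
  rewrite (@card_perm_sum n d (@simple_digraph n)).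
  have all0 : #|[set: {ffun 'I_d -> 'S_n}]|%:R != 0 :> R.
    by rewrite pnatr_eq0 -lt0n; apply/card_gt0P; exists [ffun=> 1%g].
  rewrite invfM invrK mulrA mulrAC mulfVK //; congr (_%:R / _).
  by apply: eq_card => s; rewrite [LHS]inE [RHS]inE /= [E _ && _]andbC.
- have f0 : (d`! ^ n * d`! ^ n)%:R != 0 :> R.
    by rewrite pnatr_eq0 -lt0n muln_gt0 !expn_gt0 fact_gt0.
  have := card_regular E; have := card_regular xpredT.
  have -> : #|[set B in [set B : 'M[bool]_n | regular_digraph d (adjacency B)] |
      xpredT (adjacency B)]| = #|[set B : 'M[bool]_n | regular_digraph d (adjacency B)]|.
    by apply: eq_card => B; rewrite !inE andbT.
  move=> c1 c2; rewrite -[LHS]mulr1 -[X in _ * X = _](divff f0) mulf_div -!natrM c1 c2.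
  congr (_%:R / _%:R); first by apply: eq_card => s; rewrite !inE.
  by apply: eq_card => s; rewrite !inE andbT.
Qed.

(** Makes the conditional probabilities genuine quotients, for every admissible [n] and not only for
    large [n]. *)
Lemma conditioned_gt0 m : (0 < d)%N -> admissible m d n ->
  (0 < #|[set s in family_of m | conditioned m (quotient_mx s)]|)%N.
Proof.
move=> d0 adm; apply/card_gt0P.
have glueP t : glue t \in label_preserving n d.
  by rewrite -imset_glue imset_f.
case: m adm => [_|dn|dn].
- by exists (glue [ffun=> 1%g]); rewrite inE andbT; apply: glueP.
- have [t st] := exists_simple_perm_sum d0 dn.
  by exists (glue t); rewrite inE; apply/andP; split; [exact: glueP | rewrite /= quotient_mx_glue].
- have [t st] := exists_simple_perm_sum d0 dn.
  by exists (glue t); rewrite !in_set /= quotient_mx_glue.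
Qed.

Lemma admissible_gt0 m : (0 < d)%N -> admissible m d n -> (0 < n)%N.
Proof. by case: m => //= d0 dn; apply: leq_trans dn. Qed.

Lemma card_conditioned m : (2 * (d * d + d).+1 <= n)%N ->
  (#|family_of m| <= 2 * (1 + 2 * d ^ 3) ^ (8 * d ^ 2) *
    #|[set s in family_of m | conditioned m (quotient_mx s)]|)%N.
Proof.
move=> dn; case: m; last first.
- exact: (card_simple_geq (@family_of_swap_closed RegularDigraph) dn).
- exact: (card_simple_geq (@family_of_swap_closed SimplePermSum) dn).
rewrite (_ : [set s in _ | _] = family_of PermSum); last by apply/setP => s; rewrite !inE andbT.
by rewrite leq_pmull // muln_gt0 expn_gt0.
Qed.

End Models.

Theorem theorem1p1 (R : realType) (d : nat) (hd : (1 <= d)%N) (m : model) :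
  (forall n : nat, admissible m d n ->
     model_pr R m d n (fun A : 'M[nat]_n => lambda R A 1 == d%:R) = 1) /\
  (forall eps : R, 0 < eps ->
     (fun n : nat =>
        model_pr R m d n (fun A : 'M[nat]_n =>
          (Num.sqrt (d%:R : R) + eps)%:C < `|lambda R A 2|)) @ \oo --> (0 : R)).
Proof.
split=> [n adm|eps eps0].
  rewrite model_prE; set a := #|_|; set b := #|_|.
  have -> : a = b.
    apply: eq_card => s; rewrite !inE (lambda1 R (quotient_mx_regular s)).
      by rewrite eqxx andbT.
    exact: admissible_gt0 adm.
  by rewrite divff // pnatr_eq0 -lt0n conditioned_gt0.
apply/cvgrPdist_le => del del0.
(* [c] is the inverse of the lower bound on the probability of the conditioning event; the gap is
   therefore requested with failure probability [del / c]. *)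
pose c : R := (2 * (1 + 2 * d ^ 3) ^ (8 * d ^ 2))%:R.
have c0 : 0 < c by rewrite ltr0n muln_gt0 expn_gt0.
have [n0 Hn0] := spectral_gap hd eps0 (divr_gt0 del0 c0).
exists (maxn n0 (maxn (2 * (d * d + d).+1) d)) => // n /=.
rewrite !geq_max => /and3P [nn0 nd dn].
have adm : admissible m d n by case: (m) => //=; apply: leq_trans dn.
rewrite sub0r normrN model_prE ger0_norm ?divr_ge0 ?ler0n //.
rewrite ler_pdivrMr ?ltr0n ?conditioned_gt0 //.
have := Hn0 n _ nn0 (@family_of_swap_closed n d m).
set E := #|[set s in family_of n d m | _]|%:R => lt.
apply: (@le_trans _ _ E).
  by rewrite ler_nat; apply/subset_leq_card/subsetP => s; rewrite !inE => /and3P [-> _ ->].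
apply: le_trans lt _; rewrite -mulrA ler_wpM2l ?(ltW del0) // mulrC ler_pdivrMr //.
by rewrite mulrC -natrM ler_nat; apply: card_conditioned.
Qed.
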